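(* Let $\mathcal{X}=X_1\times\dots\times X_d$, where $X_1,\dots,X_p$ are Suslin spaces and $X_{p+1},\dots,X_d$ are real intervals ($0\le p\le d$), let $a_i\in X_i$ for $p<i\le d$, and let $\varphi_i^{(j)}:X_i\to\mathbb{R}$ ($1\le j\le N_i$, $1\le i\le d$) be measurable functions. Let $\mathcal{A}_i$ and $\Delta_i(n)$ be the associated (unimodal) moment classes and sets of finite mixtures defined in the context, and $\mathcal{A}=\prod_{i=1}^d\mathcal{A}_i$. Let $\varphi^{(j)}:\mathcal{X}\to\mathbb{R}$, $1\le j\le N$, be measurable functions, and let $f:\mathcal{A}\to\mathbb{R}$ be a marginally quasi-convex and marginally lower semicontinuous function. Then $$\sup\Big\{ f(\mu_1,\dots,\mu_d)\ :\ \mu_i\in\mathcal{A}_i\ (1\le i\le d),\ \mathbb{E}_{\mu_1\otimes\dots\otimes\mu_d}[\varphi^{(j)}]\le 0\ (1\le j\le N)\Big\}$$ $$=\ \sup\Big\{ f(\mu_1,\dots,\mu_d)\ :\ \mu_i\in\Delta_i(N_i+N)\ (1\le i\le d),\ \mathbb{E}_{\mu_1\otimes\dots\otimes\mu_d}[\varphi^{(j)}]\le 0\ (1\le j\le N)\Big\}.$$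
   Context: A Suslin space is the image of a Polish space under a continuous mapping. For a topological space $X$, $\mathcal{P}(X)$ is the set of Borel probability measures on $X$, with the weak topology (the coarsest topology making $\mu\mapsto\int\phi\,d\mu$ continuous for every continuous bounded $\phi:X\to\mathbb{R}$). A constraint $\mathbb{E}_\mu[\varphi]\le 0$ is understood to include that $\varphi$ is $\mu$-integrable. For an interval $X\subset\mathbb{R}$ and $a\in X$, a probability measure $\mu$ on $X$ with distribution function $F_\mu(h)=\mu(]-\infty,h])$ is unimodal with mode $a$ if $F_\mu$ is convex on $]-\infty,a[$ and concave on $]a,+\infty[$; $\mathcal{H}_a(X)$ is the set of all such measures. $\mathcal{U}_a(X)$ is the set of uniform probability measures on the intervals $\mathrm{co}(a,z)$ (convex hull of $\{a,z\}$), $z\in X$, including the Dirac mass at $a$ (case $z=a$). The classes are - $\mathcal{A}_i=\{\mu_i\in\mathcal{P}(X_i): \mathbb{E}_{\mu_i}[\varphi_i^{(j)}]\le 0,\ 1\le j\le N_i\}$ for $1\le i\le p$; - $\mathcal{A}_i=\{\mu_i\in\mathcal{H}_{a_i}(X_i): \mathbb{E}_{\mu_i}[\varphi_i^{(j)}]\le 0,\ 1\le j\le N_i\}$ for $p<i\le d$. For an integer $n\ge 0$: - $\Delta_i(n)=\{\mu_i\in\mathcal{A}_i:\mu_i=\sum_{k=1}^{n+1}\omega_k\delta_{x_k},\ \omega_k\ge 0,\ x_k\in X_i\}$ for $1\le i\le p$; - $\Delta_i(n)=\{\mu_i\in\mathcal{A}_i:\mu_i=\sum_{k=1}^{n+1}\omega_k\mathfrak{u}_k,\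 \omega_k\ge 0,\ \mathfrak{u}_k\in\mathcal{U}_{a_i}(X_i)\}$ for $p<i\le d$. Each $\mathcal{A}_i$ carries the topology induced by $\mathcal{P}(X_i)$. A tuple $(\mu_1,\dots,\mu_d)\in\mathcal{A}$ is identified with the product measure $\mu_1\otimes\dots\otimes\mu_d$. A function $g$ on a convex set is quasi-convex if $g(\lambda x+(1-\lambda)y)\le\max\{g(x),g(y)\}$ for all $x,y$ and $\lambda\in[0,1]$. A function $f:\mathcal{A}\to\mathbb{R}$ is marginally quasi-convex (resp. marginally lower semicontinuous) if for every $i$ and all fixed $\mu_k\in\mathcal{A}_k$, $k\ne i$, the function $\mu_i\mapsto f(\mu_1,\dots,\mu_d)$ is quasi-convex (resp. lower semicontinuous) on $\mathcal{A}_i$.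
   Formalization: In U_a(X) the point z ranges over the closure of X in the real line, not just X; for closed intervals nothing changes. As worded the claim fails, e.g. X=[0,1[, a=0, one constraint E[1/2-x]<=0, N=0, f=0, where Delta is empty but A is not. *)

(* Defs.v *)
From HB Require Import structures.
From mathcomp Require Import all_boot all_order all_algebra.
From mathcomp Require Import all_classical all_reals all_analysis.
Set Implicit Arguments.
Unset Strict Implicit.
Unset Printing Implicit Defensive.
Import Order.TTheory GRing.Theory Num.Theory.
Import numFieldNormedType.Exports.
Local Open Scope classical_set_scope.
Local Open Scope ring_scope.

(* No separation axiom is imposed on T: being a continuous image of a Polish
   space is the whole definition. *)
Definition suslin (R : realType) (T : topologicalType) : Prop :=
  exists (Y : completePseudoMetricType R) (g : Y -> T),
    [/\ hausdorff_space Y, exists2 D : set Y, countable D & dense D,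
        continuous g & range g = [set: T]].

Definition borel (T : ptopologicalType) : measurableType (@open T).-sigma :=
  g_sigma_algebraType (@open T).

(* A point of J is part of the data because measurable types are pointed. *)
Definition itv_space (R : realType) (J : set R) (a : J) : Type := J.

HB.instance Definition _ (R : realType) (J : set R) (a : J) :=
  Topological.copy (itv_space a) (set_type J).
HB.instance Definition _ (R : realType) (J : set R) (a : J) :=
  isPointed.Build (itv_space a) a.

Section weak_topology.
Context (R : realType) (T : ptopologicalType).

Definition bounded_continuous : set (T -> R) :=
  [set g | continuous g /\ exists M : R, forall x, `|g x| <= M].

Definition integrals (mu : probability (borel T) R) :
    {ptws bounded_continuous -> R} :=
  fun g => \int[mu]_x (set_val g : T -> R) x.

(* The initial topology of mu |-> (\int g dmu)_g is the coarsest one making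
   every mu |-> \int g dmu continuous.  Library measures also carry values on
   non-measurable sets; probabilities which agree on Borel sets have the same
   neighbourhoods here, so a lower semicontinuous real function takes the same
   value at both. *)
Definition weak_prob : topologicalType := initial_topology integrals.

End weak_topology.
Arguments weak_prob : clear implicits.

Definition mixtures (R : realType) (T : ptopologicalType) (n : nat)
    (U : set (weak_prob R T)) : set (weak_prob R T) :=
  [set mu | exists (w : 'I_n.+1 -> R) (u : 'I_n.+1 -> weak_prob R T),
    [/\ forall k, 0 <= w k, forall k, U (u k) &
        forall B : set (borel T), measurable B ->
          mu B = (\sum_(k < n.+1) (w k)%:E * u k B)%E]].

Definition dirac_class (R : realType) (T : ptopologicalType) :
    set (weak_prob R T) :=
  [set u : weak_prob R T | exists x : borel T, forall B, measurable B -> u B = \d_x B].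

Section unimodal.
Context (R : realType) (J : set R) (a : J).
Local Notation P := (weak_prob R (itv_space a)).

Definition on_line (mu : P) : set R -> \bar R :=
  fun B => mu ((set_val : itv_space a -> R) @^-1` B).

Definition cdf_line (mu : P) (h : R) : R := fine (on_line mu `]-oo, h]).

Definition unimodal_class : set P :=
  [set mu |
    convex_function (`]-oo, set_val a[%classic : set R^o) (cdf_line mu) /\
    convex_function (`]set_val a, +oo[%classic : set R^o) (- cdf_line mu)].

(* For closed J, z ranges over J.  If J omits an endpoint z, the uniform law on
   co(a, z) still is a probability measure on J, unimodal with mode a, and it
   has to be kept: with J = [0, 1[, a = 0 and the constraint
   E[1/2 - x] <= 0, it is the only element of the moment class and it is no
   mixture of uniform laws on the [0, z], z in J. *)
Definition uniform_class : set P :=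
  [set u : P | (forall B, measurable B -> u B = \d_(a : borel (itv_space a)) B) \/
    exists2 z : R, closure J z &
      exists az : Num.min (set_val a) z < Num.max (set_val a) z,
        forall B : set R, measurable B -> on_line u B = uniform_prob az B].

End unimodal.

Lemma uniform_class_closed (R : realType) (J : set R) (a : J)
    (u : weak_prob R (itv_space a)) : closed J ->
  uniform_class u <->
  ((forall B, measurable B -> u B = \d_(a : borel (itv_space a)) B) \/
   exists z : J,
     exists az : Num.min (set_val a) (set_val z) <
                 Num.max (set_val a) (set_val z),
       forall B : set R, measurable B -> on_line u B = uniform_prob az B).
Proof.
move=> /closure_id JE; split=> -[?|]; [by left| |by left|].
  by rewrite -JE => -[z Jz uz]; right; exists (exist _ z (mem_set Jz)).
case=> z uz; right; exists (set_val z) => //.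
by apply: subset_closure; exact: set_valP.
Qed.

Section product.
Context (R : realType) (I : finType) (d : I -> measure_display)
  (T : forall i, measurableType (d i)).

Definition cylinders : set (set (forall i, T i)) :=
  [set C | exists i, exists2 B : set (T i), measurable B & C = proj i @^-1` B].

(* For Borel sigma-algebras of Suslin spaces this is also the Borel
   sigma-algebra of the product topology. *)
Definition prod_space : measurableType cylinders.-sigma :=
  g_sigma_algebraType cylinders.

Lemma measurable_proj i : measurable_fun [set: prod_space] (@proj _ T i).
Proof.
move=> _ B mB; rewrite setTI; apply: sub_sigma_algebra.
by exists i, B.
Qed.

Lemma measurable_to_prod d' (Y : measurableType d') (g : Y -> prod_space) :
  (forall i, measurable_fun [set: Y] (fun y => g y i)) ->
  measurable_fun [set: Y] g.
Proof.
move=> mg; apply: (@measurability _ _ Y prod_space setT g cylinders erefl).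
by move=> _ [_ [i [B mB ->]] <-]; exact: mg.
Qed.

Definition set_coord i (xg : T i * prod_space) : prod_space :=
  dfwith xg.2 i xg.1.

Lemma measurable_set_coord i : measurable_fun setT (@set_coord i).
Proof.
apply: measurable_to_prod => j; rewrite /set_coord.
have [<-|ij] := eqVneq i j.
  by under eq_fun do rewrite dfwithin; exact: measurable_fst.
under eq_fun do rewrite dfwithout//.
exact: (measurableT_comp (measurable_proj (i := j)) measurable_snd).
Qed.

HB.instance Definition _ i :=
  isMeasurableFun.Build _ _ _ _ (@set_coord i) (@measurable_set_coord i).

Context (mu : forall i, probability (T i) R).

Definition set_coord_prob i (P : probability prod_space R) :
    probability prod_space R :=
  distribution (mu i \x P)%E (@set_coord i).

(* Start anywhere and overwrite the coordinates one after the other by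
   independent draws from the mu i; see prod_prob_rectangle. *)
Definition prod_prob : probability prod_space R :=
  foldr set_coord_prob (\d_(point : prod_space)) (enum I).

Lemma measurable_rectangle (B : forall i, set (T i)) :
  (forall i, measurable (B i)) ->
  measurable ([set x | forall i, B i (x i)] : set prod_space).
Proof.
move=> mB; rewrite (_ : mkset _ = \bigcap_(i in [set: I]) proj i @^-1` B i).
  apply: fin_bigcap_measurable => // i _.
  by rewrite -[X in measurable X]setTI; exact: measurable_proj.
by apply/seteqP; split=> x Bx i; [move=> _; exact: Bx | exact: (Bx i Logic.I)].
Qed.

Lemma prod_prob_rectangle (B : forall i, set (T i)) :
  (forall i, measurable (B i)) ->
  prod_prob [set x | forall i, B i (x i)] = (\prod_i mu i (B i))%E.
Proof.
move=> mB; rewrite /prod_prob.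
suff H (s : seq I) : uniq s -> forall B, (forall i, measurable (B i)) ->
    foldr set_coord_prob (\d_(point : prod_space)) s [set x | forall i, B i (x i)]
    = (\prod_(i <- s) mu i (B i) *
       \d_(point : prod_space) [set x | forall i, i \notin s -> B i (x i)])%E.
  rewrite H ?enum_uniq// big_enum/= [X in (_ * X)%E](_ : _ = 1%E) ?mule1//.
  rewrite diracE mem_set// => i.
  by rewrite mem_enum.
elim: s => [_|i s IH /= /andP[si us]] {mB}B mB.
  rewrite big_nil mul1e/=; congr (\d_ _ _).
  by apply/seteqP; split=> x Bx i => [_|]; exact: Bx.
pose B' := dfwith B i [set: T i].
have mB' j : measurable (B' j) by rewrite /B'; case: dfwithP.
rewrite [LHS](_ : _ = (mu i \x foldr set_coord_prob (\d_(point : prod_space)) s)%E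
    (B i `*` [set x | forall j, B' j (x j)])); last first.
  rewrite /= /distribution /pushforward/=; congr (_ _).
  apply/seteqP; split=> -[x g] /=.
    move=> Bg; split=> [|j]; first by have := Bg i; rewrite /set_coord dfwithin.
    rewrite /B'; have [<-|ij] := eqVneq i j; first by rewrite dfwithin.
    by rewrite dfwithout//; have := Bg j; rewrite /set_coord dfwithout.
  move=> [Bx Bg] j; rewrite /set_coord.
  have [<-|ij] := eqVneq i j; first by rewrite dfwithin.
  by rewrite dfwithout//; have := Bg j; rewrite /B' dfwithout.
rewrite product_measure1E//; last exact: measurable_rectangle.
rewrite big_cons -muleA; congr (_ * _)%E.
rewrite [LHS](IH us _ mB'); congr (_ * _)%E.
  apply: eq_big_seq => j js; rewrite /B' dfwithout//.
  by apply: contraNneq si => ->.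
congr (\d_ _ _); apply/seteqP; split=> x Bx j.
  rewrite inE negb_or => /andP[ji js]; have := Bx j js.
  by rewrite /B' dfwithout// eq_sym.
move=> js; rewrite /B'; have [<-|ij] := eqVneq i j; first by rewrite dfwithin.
by rewrite dfwithout//; apply: Bx; rewrite inE negb_or eq_sym ij.
Qed.

End product.

Definition expectation_le0 (R : realType) d (T : measurableType d)
    (mu : probability T R) (g : T -> R) : Prop :=
  mu.-integrable [set: T] (EFin \o g) /\ ('E_mu[g] <= 0)%E.

Section marginal_properties.
Context (R : realType) (T : ptopologicalType).
Implicit Types (A : set (weak_prob R T)) (g : weak_prob R T -> R).

Definition quasi_convex_on A g : Prop :=
  forall (mu nu rho : weak_prob R T) (t : R),
    A mu -> A nu -> A rho -> 0 <= t <= 1 ->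
    (forall B : set (borel T), measurable B ->
      rho B = (t%:E * mu B + (1 - t)%:E * nu B)%E) ->
    g rho <= Num.max (g mu) (g nu).

(* Points outside A are isolated in subspace A, so this is lower
   semicontinuity of the restriction of g to A. *)
Definition lower_semicontinuous_on A g : Prop :=
  lower_semicontinuous (fun mu : subspace A => (g mu)%:E).

End marginal_properties.

Section classes.
Context (R : realType) (p q : nat) (S : 'I_p -> ptopologicalType)
  (J : 'I_q -> set R) (a : forall k, J k).

(* d = p + q: the Suslin factors are indexed on the left, the intervals on the
   right. *)
Definition factor_space (i : 'I_p + 'I_q) : ptopologicalType :=
  match i with
  | inl k => S k
  | inr k => itv_space (a k)
  end.

Definition base_class (i : 'I_p + 'I_q) : set (weak_prob R (factor_space i)) :=
  match i with
  | inl k => setT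
  | inr k => @unimodal_class R (J k) (a k)
  end.

Definition generators (i : 'I_p + 'I_q) : set (weak_prob R (factor_space i)) :=
  match i with
  | inl k => @dirac_class R (S k)
  | inr k => @uniform_class R (J k) (a k)
  end.

Definition product_space :=
  prod_space (fun i : 'I_p + 'I_q => borel (factor_space i)).

Definition measure_tuple := forall i, weak_prob R (factor_space i).

Definition product_measure (mu : measure_tuple) :
    probability product_space R :=
  prod_prob (fun i => mu i : probability (borel (factor_space i)) R).

Arguments base_class : clear implicits.
Arguments generators : clear implicits.

Section constraints.
Context (Nm : 'I_p + 'I_q -> nat) (phi : forall i, 'I_(Nm i) -> factor_space i -> R).

Definition moment_class i : set (weak_prob R (factor_space i)) :=
  [set mu | base_class i mu /\
    forall j, expectation_le0 (mu : probability (borel (factor_space i)) R) (phi j)].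

Arguments moment_class : clear implicits.

Definition Delta (n : nat) i : set (weak_prob R (factor_space i)) :=
  moment_class i `&` mixtures n (generators i).

End constraints.


Definition feasible (K : forall i, set (weak_prob R (factor_space i))) (N : nat)
    (Phi : 'I_N -> product_space -> R) : set measure_tuple :=
  [set mu | (forall i, K i (mu i)) /\
    forall j, expectation_le0 (product_measure mu) (Phi j)].

Definition marginally
    (Q : forall i, set (weak_prob R (factor_space i)) ->
                   (weak_prob R (factor_space i) -> R) -> Prop)
    (K : forall i, set (weak_prob R (factor_space i))) (f : measure_tuple -> R) :
    Prop :=
  forall i (mu : measure_tuple), (forall k, k != i -> K k (mu k)) ->
    Q i (K i) (fun nu => f (dfwith mu i nu)).

End classes.

Arguments moment_class {R p q S J a Nm} phi i _.
Arguments Delta {R p q S J a Nm} phi n i _.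

(* Main.v *)
Require Import Defs.
From HB Require Import structures.
From mathcomp Require Import all_boot all_order all_algebra.
From mathcomp Require Import all_classical all_reals all_analysis measurable_realfun.
From mathcomp Require Import ring lra.
Import Order.TTheory GRing.Theory Num.Theory.
Import numFieldNormedType.Exports.
Set Implicit Arguments.
Unset Strict Implicit.
Unset Printing Implicit Defensive.
Local Open Scope classical_set_scope.
Local Open Scope ring_scope.

(** Freeze all coordinates but one: by Fubini every constraint, including those
    on the product measure, becomes an integral constraint on that single
    marginal [mu].  Every probability measure is a mixture of Dirac masses and,
    by Khinchin's theorem, every unimodal one a mixture of uniform laws; so for
    finitely many integrable functions there is a *finite* mixture [nu] of
    generators with exactly the same integrals as [mu] (Richter-Tchakaloff).
    Weak neighbourhoods only test finitely many integrals, hence by lower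
    semicontinuity [nu] can be chosen with [f nu > c] whenever [f mu > c].
    Finally the weights of [nu] range over a polytope cut out by the constraints
    and every point of it is a convex combination of points with few nonzero
    weights, so quasi-convexity yields a mixture with few generators.  No
    compactness or Choquet theory is needed, as the integrals match exactly. *)

(** * Vector integrals are finite nonnegative combinations of values *)

(** The two stages preserve different things. The generators are selected once, by matching every
    test function: the constraints, the integrals defining a weak neighbourhood, and auxiliary
    functions carrying integrability. The weights are then reduced while keeping only the [Nm i + N]
    constraints and the total mass, whence [Nm i + N + 1] generators. The value of [f] is not
    followed along that reduction: were it at most [c] on all small mixtures, quasi-convexity would
    bound it by [c] on every feasible mixture of the selected generators.

    The obstacle is integrability, a part of every constraint. For the product measure it is a
    condition on sections, which may fail on a null set of the marginal; section norms and the
    indicator of that null set turn it into finitely many integrals of the marginal.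

    For unimodal laws the density is a monotone limit of difference quotients of the distribution
    function, and the uniform laws are horizontal sections of its hypograph. Finitely many heights
    are picked by the same combination lemma, applied to the integral over heights. *)

Section tensor.
Context d1 d2 (T1 : measurableType d1) (T2 : measurableType d2) (R : realType).
Variables (m1 : {sigma_finite_measure set T1 -> \bar R})
  (m2 : {sigma_finite_measure set T2 -> \bar R}).
Variables (g1 : T1 -> R) (g2 : T2 -> R).
Hypotheses (ig1 : m1.-integrable setT (EFin \o g1))
  (ig2 : m2.-integrable setT (EFin \o g2)).

Lemma integrable_tensor :
  (m1 \x m2)%E.-integrable setT (EFin \o (fun z => g1 z.1 * g2 z.2)).
Proof.
have mg1 : measurable_fun setT g1 by apply/measurable_EFinP; case/integrableP: ig1.
have mg2 : measurable_fun setT g2 by apply/measurable_EFinP; case/integrableP: ig2.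
apply/integrable12ltyP.
  apply/measurable_EFinP; apply: measurable_funM.
    exact: measurableT_comp.
  exact: measurableT_comp.
have [_ fin1] := integrableP _ _ _ ig1; have [_ fin2] := integrableP _ _ _ ig2.
under eq_integral => x _.
  under eq_integral => y _ do rewrite /= normrM EFinM.
  rewrite ge0_integralZl//; last first.
    by do 2 apply: measurableT_comp => //.
  over.
rewrite /= ge0_integralZr//.
- by rewrite lte_mul_pinfty// ?integral_ge0// ge0_fin_numE// integral_ge0.
- by do 2 apply: measurableT_comp => //.
- exact: integral_ge0.
Qed.

Lemma Rintegral_tensor :
  \int[(m1 \x m2)%E]_z (g1 z.1 * g2 z.2) =
  (\int[m1]_x g1 x) * (\int[m2]_y g2 y).
Proof.
rewrite /Rintegral -(integral12_prod_meas1 integrable_tensor) /fubini_F /=.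
under eq_integral => x _.
  under eq_integral => y _ do rewrite EFinM.
  rewrite integralZl//.
  over.
have fin2 : (\int[m2]_y (g2 y)%:E)%E \is a fin_num by exact: integrable_fin_num.
rewrite /= -(fineK fin2) integralZr//= fineM//.
exact: integrable_fin_num.
Qed.

End tensor.

Section square.
Local Open Scope ereal_scope.
Context d (T : measurableType d) (R : realType)
  (m : {sigma_finite_measure set T -> \bar R}).

Let square_sigma_finite : sigma_finite setT (m \x m).
Proof.
have /sigma_finiteP[F [FT ndF Foo]] := sigma_finiteT m.
exists (fun n => F n `*` F n) => [|k].
  apply/seteqP; split=> // -[x y] _.
  have [[i _ Fx] [j _ Fy]] : (\bigcup_n F n) x /\ (\bigcup_n F n) y by rewrite -FT.
  exists (maxn i j) => //; split => /=.
    exact: (subsetPset _ _ (ndF _ _ (leq_maxl i j))).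
  exact: (subsetPset _ _ (ndF _ _ (leq_maxr i j))).
have [mF Ffin] := Foo k; split; first exact: measurableX.
by rewrite product_measure1E// lte_mul_pinfty// ge0_fin_numE.
Qed.

(** Packs the square with a sigma-finite structure, so that the induction below can pass to it and
    square again. *)
Definition square_measure : {sigma_finite_measure set (T * T)%type -> \bar R} :=
  HB.pack_for {sigma_finite_measure set (T * T)%type -> \bar R} (m \x m)
    (Measure_isSigmaFinite.Build _ _ _ (m \x m) square_sigma_finite).

End square.

Section combination.
Context (R : realType).

(* Each step replaces the measure space by its square.  The averaging
   [G |-> H^+(x) G(y) 1_{H <= 0}(y) + G(x) 1_{0 < H}(x) H^-(y)] multiplies all
   integrals by [\int H^+], kills [H] identically, and takes values in the cone
   spanned by [G x] and [G y]. *)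
Lemma exists_vanishing_combination n : forall d (T : measurableType d)
    (m : {sigma_finite_measure set T -> \bar R}) (h : T -> R)
    (H : 'I_n -> T -> R),
  m.-integrable setT (EFin \o h) -> (forall x, 0 <= h x) ->
  0 < \int[m]_x h x ->
  (forall j, m.-integrable setT (EFin \o H j)) ->
  (forall j, \int[m]_x H j x = 0) ->
  exists s : seq (R * T),
    [/\ all (fun c => 0 < c.1) s,
        forall j, \sum_(c <- s) c.1 * H j c.2 = 0 &
        0 < \sum_(c <- s) c.1 * h c.2].
Proof.
elim: n => [|n IH] d T m h H ih h0 inth iH intH.
  have [[x hx]|nh] := pselect (exists x, 0 < h x).
    exists [:: (1, x)]; split => [|[]//|]; first by rewrite /= ltr01.
    by rewrite big_seq1 mul1r.
  move: inth; rewrite (_ : h = cst 0) ?Rintegral_cst ?mul0r ?ltxx//.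
  apply/funext => x /=; apply/eqP; rewrite eq_le h0 andbT leNgt.
  by apply/negP => hx; apply: nh; exists x.
pose K := H ord0; pose c := \int[m]_x K^\+ x.
have iK : m.-integrable setT (EFin \o K) by exact: iH.
have mK : measurable_fun setT K by apply/measurable_EFinP; case/integrableP: iK.
have iKp : m.-integrable setT (EFin \o K^\+) by exact: integrable_funrpos.
have iKn : m.-integrable setT (EFin \o K^\-) by exact: integrable_funrneg.
have cE : \int[m]_x K^\- x = c.
  apply/eqP; rewrite eq_sym -subr_eq0 -RintegralB//; apply/eqP.
  rewrite -[RHS](intH ord0); apply: eq_Rintegral => x _.
  by rewrite -[in RHS](funrposBneg (H ord0)).
have Kpos x : 0 <= K^\+ x by rewrite /funrpos le_max lexx orbT.
have Kneg x : 0 <= K^\- x by rewrite /funrneg le_max lexx orbT.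
pose N := K @^-1` `]-oo, 0]; pose P := K @^-1` `]0, +oo[.
have mN : measurable N.
  by rewrite -[N]setTI; apply: mK => //; exact: measurable_itv.
have mP : measurable P.
  by rewrite -[P]setTI; apply: mK => //; exact: measurable_itv.
have inN x : (x \in N) = (K x <= 0).
  by apply/idP/idP; rewrite inE /N/= in_itv.
have inP x : (x \in P) = (0 < K x).
  by apply/idP/idP; rewrite inE /P/= in_itv/= andbT.
have NP : [disjoint N & P].
  apply/disj_setPS => x []; rewrite /N /P/= !in_itv/= andbT => /le_lt_trans/[apply].
  by rewrite ltxx.
have NPT : N `|` P = setT.
  apply/seteqP; split => // x _; rewrite /N /P/= !in_itv/= andbT.
  by case: (leP (K x) 0); [left|right].
have c0 : 0 <= c by exact: Rintegral_ge0.
have ires G D : measurable D -> m.-integrable setT (EFin \o G) ->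
    m.-integrable setT (EFin \o (G \_ D)).
  move=> mD iG; rewrite -restrict_EFin.
  have := integrable_mkcond (EFin \o G) mD.
  by rewrite /= => <-; exact: integrableS iG.
(* Squaring needs [0 < c], because the integral of [tr h] is [c] times that of [h] and must stay
   positive. If [c = 0], then [K] vanishes almost everywhere, and restricting all functions to its
   zero set [Z] kills it on the same space. *)
move: c0; rewrite le_eqVlt => /orP[/eqP/esym c00|c0].
- have absK : (\int[m]_x `|(EFin \o K) x| = 0)%E.
    have -> : (\int[m]_x `|(EFin \o K) x| = (\int[m]_x (K^\+ x + K^\- x))%:E)%E.
      rewrite /Rintegral fineK.
        apply: eq_integral => x _ /=; congr EFin.
        by rewrite -[in LHS]/((Num.norm \o K) x) -funrposDneg.
      apply: integrable_fin_num => //.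
      have := integrableD measurableT iKp iKn.
      by apply: eq_integrable => // x _.
    by rewrite RintegralD// cE -/c c00 addr0.
  have mK' : measurable_fun setT (EFin \o K) by exact/measurable_EFinP.
  have K0 := (ae_eq_integral_abs _ measurableT mK').1 absK.
  pose Z := K @^-1` [set 0].
  have mZ : measurable Z.
    by rewrite -[Z]setTI; apply: mK => //; exact: measurable_set1.
  have intZ G : m.-integrable setT (EFin \o G) ->
      \int[m]_x (G \_ Z) x = \int[m]_x G x.
    move=> iG; congr fine; apply: ae_eq_integral => //.
    - by have /integrableP[] := ires G Z mZ iG.
    - by case/integrableP: iG.
    - apply: filterS K0 => x /= /(_ Logic.I)[] Kx _.
      by rewrite /patch mem_set.
  have := IH _ _ m (h \_ Z) (fun j => H (lift ord0 j) \_ Z).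
  case.
  + exact: ires.
  + by move=> x; rewrite /patch; case: ifP.
  + by rewrite intZ.
  + by move=> j; exact: ires.
  + by move=> j; rewrite intZ.
  move=> s [s0 sH sh].
  exists [seq z <- s | z.2 \in Z].
  have sE G : \sum_(c <- [seq z <- s | z.2 \in Z]) c.1 * G c.2 =
              \sum_(c <- s) c.1 * (G \_ Z) c.2.
    rewrite big_filter big_mkcond/=; apply: eq_bigr => z _; rewrite /patch.
    by case: ifP; rewrite ?mulr0.
  split; last by rewrite sE.
    by apply/allP => z; rewrite mem_filter => /andP[_]; exact: (allP s0).
  move=> j; rewrite sE.
  case: (unliftP ord0 j) => [k ->|->]; first exact: sH.
  rewrite big1// => z _; rewrite /patch; case: ifPn; rewrite ?mulr0//.
  by rewrite inE /Z/= /K => ->; rewrite mulr0.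
pose tr (G : T -> R) := fun z : T * T =>
  K^\+ z.1 * (G \_ N) z.2 + (G \_ P) z.1 * K^\- z.2.
have itr G : m.-integrable setT (EFin \o G) ->
    (m \x m)%E.-integrable setT (EFin \o tr G).
  move=> iG.
  have := @integrableD _ _ _ (m \x m)%E setT measurableT
    _ _ (integrable_tensor iKp (ires G N mN iG)) (integrable_tensor (ires G P mP iG) iKn).
  by apply: eq_integrable => // z _.
have trE G : m.-integrable setT (EFin \o G) ->
    \int[(m \x m)%E]_z tr G z = c * \int[m]_x G x.
  move=> iG; rewrite /tr RintegralD//; last 2 first.
    - exact: (integrable_tensor iKp (ires G N mN iG)).
    - exact: (integrable_tensor (ires G P mP iG) iKn).
  rewrite !Rintegral_tensor// ?cE; do ?exact: ires.
  rewrite -/c [X in _ + X]mulrC -mulrDr -!Rintegral_mkcond -Rintegral_setU//.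
    by rewrite NPT.
  by rewrite NPT.
(* A weighted point of the square unfolds into at most two weighted points of [T], independently of
   [G], so one list serves all functions. *)
pose ct (z : R * (T * T)) : seq (R * T) :=
  (if K z.2.2 <= 0 then [:: (z.1 * K^\+ z.2.1, z.2.2)] else [::]) ++
  (if 0 < K z.2.1 then [:: (z.1 * K^\- z.2.2, z.2.1)] else [::]).
have ctE G z : \sum_(c <- ct z) c.1 * G c.2 = z.1 * tr G z.2.
  rewrite /ct /tr big_cat/= /patch mulrDr; congr (_ + _).
    rewrite inN; case: ifPn => _; rewrite ?big_seq1 ?big_nil ?mulr0//.
    by rewrite mulrA.
  rewrite inP; case: ifPn => _; rewrite ?big_seq1 ?big_nil ?mul0r ?mulr0//.
  by rewrite -mulrA; congr (_ * _); rewrite mulrC.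
have := IH _ _ (square_measure m) (tr h) (fun j => tr (H (lift ord0 j))).
case.
- exact: itr.
- move=> z; rewrite addr_ge0// mulr_ge0// /patch; by case: ifP.
- by rewrite trE// mulr_gt0.
- by move=> j; apply: itr.
- by move=> j; rewrite trE// intH mulr0.
move=> s [s0 sH sh].
pose s' := flatten [seq ct z | z <- s].
have s'0 z : z \in s' -> 0 <= z.1.
  move=> /flattenP[_ /mapP[w ws ->]]; rewrite /ct mem_cat => /orP[].
    case: ifP => // _; rewrite inE => /eqP -> /=.
    by rewrite mulr_ge0// ltW// (allP s0).
  case: ifP => // _; rewrite inE => /eqP -> /=.
  by rewrite mulr_ge0// ltW// (allP s0).
(* Weights produced by [ct] can be 0, as [K^\+] or [K^\-] may vanish; dropping those points restores
   strict positivity. *)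
have sE G : \sum_(c <- [seq z <- s' | 0 < z.1]) c.1 * G c.2 =
            \sum_(z <- s) z.1 * tr G z.2.
  rewrite big_filter big_mkcond/=.
  rewrite (eq_big_seq (fun z => z.1 * G z.2)); last first.
    move=> z /s'0 z0; case: ifPn => //; rewrite -leNgt => z0'.
    by rewrite (@le_anti _ _ z.1 0) ?mul0r// z0 z0'.
  by rewrite big_flatten/= big_map; apply: eq_bigr => z _; rewrite ctE.
exists [seq z <- s' | 0 < z.1]; split.
- by apply/allP => z; rewrite mem_filter => /andP[].
- move=> j; rewrite sE.
  case: (unliftP ord0 j) => [k ->|->]; first exact: sH.
  rewrite big1// => z _; rewrite /tr.
  rewrite (_ : _ + _ = 0) ?mulr0//.
  rewrite -/K /patch inN inP /funrpos /funrneg.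
  case: (leP (K z.2.2) 0) => k2; case: (ltP 0 (K z.2.1)) => k1.
  + by rewrite max_l ?oppr_ge0// mulrN subrr.
  + by rewrite !mul0r addr0.
  + by rewrite max_r ?oppr_le0 ?ltW// !mulr0 addr0.
  + by rewrite mulr0 mul0r addr0.
- by rewrite sE.
Qed.

(** Subtracting from [H j] the multiple [q j * h] with the same integral reduces to vanishing
    integrals; the points found then have the right proportions, and one rescaling by [r] makes them
    exact. The reference function [h] is not fixed to 1 because the lemma also serves for Lebesgue
    measure, where constants are not integrable. *)
Lemma exists_combination n d (T : measurableType d)
    (m : {sigma_finite_measure set T -> \bar R}) (h : T -> R)
    (H : 'I_n -> T -> R) :
  m.-integrable setT (EFin \o h) -> (forall x, 0 <= h x) ->
  0 < \int[m]_x h x ->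
  (forall j, m.-integrable setT (EFin \o H j)) ->
  exists s : seq (R * T),
    [/\ all (fun c => 0 < c.1) s,
        forall j, \sum_(c <- s) c.1 * H j c.2 = \int[m]_x H j x &
        \sum_(c <- s) c.1 * h c.2 = \int[m]_x h x].
Proof.
move=> ih h0 inth iH; set I := \int[m]_x h x.
pose q j := (\int[m]_x H j x) / I.
have iqh j : m.-integrable setT (EFin \o (fun x => q j * h x)).
  by have := integrableZl measurableT (q j) ih; apply: eq_integrable.
have [||s [s0 sH sh]] := exists_vanishing_combination
    (H := fun j x => H j x - q j * h x) ih h0 inth.
- move=> j; have := integrableB measurableT (iH j) (iqh j).
  by apply: eq_integrable.
- by move=> j; rewrite RintegralB// RintegralZl// -/I /q divfK ?gt_eqF// subrr.
pose r := I / \sum_(c <- s) c.1 * h c.2.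
have r0 : 0 < r by rewrite divr_gt0.
have sE (G : T -> R) : \sum_(c <- [seq (r * c.1, c.2) | c <- s]) c.1 * G c.2 =
    r * \sum_(c <- s) c.1 * G c.2.
  by rewrite big_map mulr_sumr; apply: eq_bigr => c _; rewrite mulrA.
exists [seq (r * c.1, c.2) | c <- s]; split.
- by rewrite all_map; apply/allP => c cs /=; rewrite mulr_gt0// (allP s0).
- move=> j; rewrite sE.
  have -> : \sum_(c <- s) c.1 * H j c.2 = q j * \sum_(c <- s) c.1 * h c.2.
    apply/eqP; rewrite -subr_eq0 mulr_sumr -sumrB -[X in _ == X](sH j).
    by apply/eqP/eq_bigr => c _; rewrite mulrBr mulrCA.
  by rewrite /r mulrCA divfK ?gt_eqF// /q divfK ?gt_eqF.
- by rewrite sE /r divfK ?gt_eqF.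
Qed.

End combination.

(** * Finite mixtures and weak neighbourhoods *)

Section total1.
Context d (T : measurableType d) (R : realType) (mu : {measure set T -> \bar R})
  (mu1 : mu setT = 1%E).

(** The mass equation is an argument of the alias so that the probability structure can be attached
    to it. *)
Definition total1_measure of mu setT = 1%E : set T -> \bar R := mu.

HB.instance Definition _ := Measure.on (total1_measure mu1).
HB.instance Definition _ :=
  Measure_isProbability.Build _ _ _ (total1_measure mu1) mu1.

End total1.

Section mixture.
Context d (T : measurableType d) (R : realType).
Implicit Types (mu : {measure set T -> \bar R}).

Definition is_mixture K (w : 'I_K -> R) (u : 'I_K -> set T -> \bar R)
    (mu : set T -> \bar R) :=
  forall B, measurable B -> mu B = (\sum_(k < K) (w k)%:E * u k B)%E.

Lemma exists_mixture_measure K (w : 'I_K -> R)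
    (u : 'I_K -> {measure set T -> \bar R}) : (forall k, 0 <= w k) ->
  exists mu : {measure set T -> \bar R}, is_mixture w (fun k => u k) mu.
Proof.
elim: K w u => [|K IH] w u w0.
  by exists (@mzero _ T R) => B mB; rewrite big_ord0.
have [mu muE] := IH (w \o lift ord0) (u \o lift ord0) (fun k => w0 _).
exists (measure_add (mscale (NngNum (w0 ord0)) (u ord0)) mu) => B mB.
by rewrite [LHS]measure_addE big_ord_recl muE.
Qed.

Lemma exists_mixture K (w : 'I_K -> R) (u : 'I_K -> probability T R) :
  (forall k, 0 <= w k) -> \sum_k w k = 1 ->
  exists mu : probability T R, is_mixture w (fun k => u k) mu.
Proof.
move=> w0 w1.
have [mu muE] := exists_mixture_measure (fun k => u k) w0.
have mu1 : mu setT = 1%E.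
  rewrite muE//; rewrite (eq_bigr (fun k => (w k)%:E)) => [|k _]; last first.
    by rewrite [X in (_ * X)%E](probability_setT (u k)) mule1.
  by rewrite sumEFin w1.
by exists (total1_measure mu1).
Qed.

Lemma ge0_integral_mixture K (w : 'I_K -> R)
    (u : 'I_K -> {measure set T -> \bar R}) mu (F : T -> \bar R) :
  (forall k, 0 <= w k) -> is_mixture w (fun k => u k) mu ->
  measurable_fun setT F -> (forall x, 0 <= F x)%E ->
  (\int[mu]_x F x = \sum_(k < K) (w k)%:E * \int[u k]_x F x)%E.
Proof.
elim: K w u mu => [|K IH] w u mu w0 muE mF F0.
  rewrite (eq_measure_integral (@mzero _ T R)).
    by rewrite big_ord0 integral_measure_zero.
  by move=> B mB _; rewrite muE// big_ord0.
have [nu nuE] := exists_mixture_measure (u \o lift ord0) (fun k => w0 (lift ord0 k)).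
rewrite (eq_measure_integral
  (measure_add (mscale (NngNum (w0 ord0)) (u ord0)) nu)); last first.
  by move=> B mB _; rewrite muE// [RHS]measure_addE big_ord_recl nuE.
rewrite ge0_integral_measure_add// ge0_integral_mscale// big_ord_recl.
congr (_ + _)%E.
exact: (IH (w \o lift ord0) (u \o lift ord0) nu (fun k => w0 _) nuE mF F0).
Qed.

Section real.
Context K (w : 'I_K -> R) (u : 'I_K -> {measure set T -> \bar R}) (mu : {measure set T -> \bar R}).
Hypotheses (w0 : forall k, 0 <= w k) (muE : is_mixture w (fun k => u k) mu).
Variable (F : T -> R).
Hypotheses (mF : measurable_fun setT F)
  (iF : forall k, (u k).-integrable setT (EFin \o F)).

Lemma integrable_mixture : mu.-integrable setT (EFin \o F).
Proof.
apply/integrableP; split; first exact/measurable_EFinP.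
rewrite (ge0_integral_mixture w0 muE)//; last first.
  by apply: measurableT_comp => //; exact/measurable_EFinP.
apply: lte_sum_pinfty => k _; rewrite lte_mul_pinfty ?lee_fin//.
by have /integrableP[] := iF k.
Qed.

Lemma Rintegral_mixture :
  \int[mu]_x F x = \sum_(k < K) w k * \int[u k]_x F x.
Proof.
have pos (G : T -> R) : measurable_fun setT G -> (forall x, 0 <= G x) ->
    (forall k, (u k).-integrable setT (EFin \o G)) ->
    \int[mu]_x G x = \sum_(k < K) w k * \int[u k]_x G x.
  move=> mG G0 iG; rewrite /Rintegral (ge0_integral_mixture w0 muE)//; last first.
  - exact/measurable_EFinP.
  - under eq_bigr => k _ do rewrite -(fineK (integrable_fin_num measurableT (iG k))) -EFinM.
    by rewrite sumEFin.
have iP := fun k => integrable_funrpos measurableT (iF k).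
have iN := fun k => integrable_funrneg measurableT (iF k).
have E (m : {measure set T -> \bar R}) : m.-integrable setT (EFin \o F) ->
    \int[m]_x F x = \int[m]_x F^\+ x - \int[m]_x F^\- x.
  move=> imF; rewrite -RintegralB//.
  - by apply: eq_Rintegral => x _; rewrite -[in LHS](funrposBneg F).
  - exact: integrable_funrpos.
  - exact: integrable_funrneg.
rewrite E ?pos//; last exact: integrable_mixture.
- rewrite -sumrB; apply: eq_bigr => k _; by rewrite E// mulrBr.
- exact: measurable_funrneg.
- exact: measurable_funrpos.
Qed.

End real.

End mixture.

Section weak_nbhs.
Context (R : realType) (T : ptopologicalType).

(** The sets containing every function that agrees with [h0] at some finite list of points form a
    filter [G]. It converges to [h0] in each coordinate, hence in the product topology, so every
    neighbourhood of [h0] belongs to it. *)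
Lemma ptws_nbhs (U : Type) (h0 : {ptws U -> R}) (V : set {ptws U -> R}) :
  nbhs h0 V ->
  exists n (t : 'I_n -> U), forall h, (forall k, h (t k) = h0 (t k)) -> V h.
Proof.
pose G : set_system {ptws U -> R} := [set B | exists n (t : 'I_n -> U),
  forall h : U -> R, (forall k, h (t k) = h0 (t k)) -> B h].
have FG : Filter G.
  split.
  - by exists 0%N, (fun k : 'I_0 => match notF (ltn_ord k) with end).
  - move=> A B [m [s sA]] [n [t tB]].
    exists (m + n)%N, (fun k => match fintype.split k with inl i => s i | inr i => t i end).
    move=> h hst; split; [apply: sA => k|apply: tB => k].
      by have := hst (lshift n k); rewrite (unsplitK (inl k)).
    by have := hst (rshift m k); rewrite (unsplitK (inr k)).
  - by move=> A B AB [n [t tA]]; exists n, t => h /tA/AB.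
suff : G --> h0 by move=> /[apply]; rewrite nbhs_filterE.
apply/cvg_sup => t A.
have /= -> := @nbhsE (initial_topology (fun f : U -> R => f t)) h0.
case=> _ [[C oC <-] Ch0] CA; exists 1%N, (fun=> t) => h /(_ ord0) ht.
by apply: CA; rewrite /preimage/= ht.
Qed.

Lemma weak_prob_nbhs (mu : weak_prob R T) (V : set (weak_prob R T)) :
  nbhs mu V ->
  exists n (g : 'I_n -> T -> R), (forall k, bounded_continuous (g k)) /\
    forall nu : weak_prob R T,
      (forall k, \int[nu : probability (borel T) R]_x g k x =
                 \int[mu : probability (borel T) R]_x g k x) -> V nu.
Proof.
rewrite nbhsE => -[_ [[C oC <-] Cmu] CV].
have [n [t tC]] := ptws_nbhs (open_nbhs_nbhs (conj oC Cmu)).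
exists n, (fun k => set_val (t k)); split=> [k|nu nuE]; first exact: set_valP.
by apply: CV; apply: tC => k; exact: nuE.
Qed.

Lemma bounded_continuous_integrable (g : T -> R) (mu : probability (borel T) R) :
  bounded_continuous g -> mu.-integrable setT (EFin \o g : borel T -> \bar R).
Proof.
move=> [cg [M gM]]; apply: measurable_bounded_integrable => //.
- by rewrite [X in (X < _)%E](probability_setT mu) ltry.
- apply: (measurability _ (RGenOInfty.measurableE R)) => //.
  move=> _ [_ [x ->] <-]; rewrite setTI; apply: sub_sigma_algebra.
  by apply: open_comp => // y _; exact: cg.
- exists M; split; first exact: num_real.
  by move=> y My x _ /=; apply: le_trans (ltW My).
Qed.

End weak_nbhs.

(** * Reducing the support of feasible weights *)

Section support_reduction.
Context (R : realType) (I : finType).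
Implicit Types (w v : I -> R).

Definition nonzeros w : {set I} := [set k | w k != 0].

(** [B] has more rows than columns, so its left kernel is nonzero; [v] is a kernel vector extended
    by 0 outside [S]. *)
Lemma exists_dependency (D : finType) (a : D -> I -> R) (S : {set I}) : (#|D| < #|S|)%N ->
  exists v, [/\ exists k, v k != 0, forall k, k \notin S -> v k = 0 &
    forall d, \sum_k v k * a d k = 0].
Proof.
move=> DS.
pose B := \matrix_(i < #|S|, j < #|D|) a (enum_val j) (enum_val i).
have : kermx B != 0.
  rewrite kermx_eq0 /row_free; apply: contraTN DS => /eqP <-.
  by rewrite -leqNgt rank_leq_col.
case/rowV0Pn => x /sub_kermxP xB /rV0Pn[i xi].
exists (fun k => \sum_(j < #|S| | enum_val j == k) x ord0 j); split.
- exists (enum_val i); rewrite (big_pred1 i)// => j /=.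
  by rewrite (inj_eq enum_val_inj).
- move=> k kS; rewrite big_pred0// => j; apply/negbTE.
  by apply: contraNneq kS => <-; exact: enum_valP.
- move=> d; have /matrixP/(_ ord0 (enum_rank d)) := xB; rewrite !mxE => xd.
  rewrite -[RHS]xd.
  under eq_bigr do rewrite mulr_suml.
  rewrite (exchange_big_dep predT)//=; apply: eq_bigr => j _.
  by rewrite (big_pred1 (enum_val j))// mxE enum_rankK.
Qed.

(** The ratio test of the simplex method: [t] is the least [w k / - v k] over the decreasing
    entries, so the minimising entry [m] reaches 0 first. Zero entries of [w] stay zero since [v]
    vanishes there, which also forces [0 < t]. *)
Lemma move_to_boundary w v : (forall k, 0 <= w k) ->
    (forall k, w k = 0 -> v k = 0) -> (exists k, v k < 0) ->
  exists2 t, 0 < t & (forall k, 0 <= w k + t * v k) /\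
    (#|nonzeros (fun k => (w k + t * v k)%R)| < #|nonzeros w|)%N.
Proof.
move=> w0 wv [k0 vk0].
pose m := [arg min_(k < k0 | v k < 0) (w k / - v k)]%O.
have : v m < 0 /\ forall k, v k < 0 -> w m / - v m <= w k / - v k.
  by rewrite /m; case: Order.TotalTheory.arg_minP => // k.
move=> [vm wm]; set t := w m / - v m in wm *.
have nvm : 0 < - v m by rewrite oppr_gt0.
have wm0 : w m != 0 by apply: contraTneq vm => /wv ->; rewrite ltxx.
have t0 : 0 < t by rewrite divr_gt0// lt_neqAle eq_sym wm0 w0.
exists t => //; split.
  move=> k; have [vk|vk] := ltP (v k) 0; last by rewrite addr_ge0// mulr_ge0// ltW.
  by have := wm _ vk; rewrite ler_pdivlMr ?oppr_gt0// mulrN -subr_ge0 opprK.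
apply: proper_card; apply/fintype.properP; split.
  apply/fintype.subsetP => k; rewrite /nonzeros !inE; apply: contraNneq => wk.
  by rewrite wk (wv _ wk) mulr0 addr0.
exists m; rewrite /nonzeros !inE// negbK /t invrN mulrN mulNr divfK ?subrr//.
by rewrite lt_eqF.
Qed.

Variables (D : finType) (a : D -> I -> R).

Definition feasible_weights w := [/\ forall k, 0 <= w k, \sum_k w k = 1 &
  forall d, \sum_k w k * a d k <= 0].

(* A feasible weight with more than [#|D| + 1] nonzero entries is not a vertex:
   it can be moved in two opposite directions, keeping all the sums, until one
   more entry vanishes. *)
Lemma feasible_weights_ind (P : (I -> R) -> Prop) :
  (forall w, feasible_weights w -> (#|nonzeros w| <= #|D|.+1)%N -> P w) ->
  (forall w1 w2 t, feasible_weights w1 -> feasible_weights w2 -> 0 <= t <= 1 ->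
    P w1 -> P w2 -> P (fun k => t * w1 k + (1 - t) * w2 k)) ->
  forall w, feasible_weights w -> P w.
Proof.
move=> Psmall Pconv w.
have [n] := ubnP #|nonzeros w|; elim: n w => // n IH w wn fw.
have [ws|ws] := leqP #|nonzeros w| #|D|.+1; first exact: Psmall.
have [w0 w1 wa] := fw.
(* [None] adds the equation that preserves the total mass: [#|D|.+1] equations, still fewer than the
   nonzero entries of [w]. *)
pose b (d : option D) k := if d is Some d' then a d' k else 1.
have [|v [[k0 vk0] vS vb]] := @exists_dependency _ b (nonzeros w).
  by rewrite card_option.
have va d : \sum_k v k * a d k = 0 by exact: (vb (Some d)).
have v1 : \sum_k v k = 0.
  by rewrite -[RHS](vb None); apply: eq_bigr => k _; rewrite mulr1.
have wv k : w k = 0 -> v k = 0 by move=> wk; rewrite vS// inE wk eqxx.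
(* Used for both [v] and [- v], so that each of the two opposite directions eventually hits a face
   of the orthant. *)
have ex_lt0 (u : I -> R) : (exists k, u k != 0) -> \sum_k u k = 0 ->
    exists k, u k < 0.
  move=> [k uk] u1; apply: contrapT => nu.
  have u0 i : true -> 0 <= u i.
    by move=> _; rewrite leNgt; apply/negP => ui; apply: nu; exists i.
  move/eqP: u1; rewrite psumr_eq0// => /allP/(_ k)/=.
  by rewrite mem_index_enum (negbTE uk) => /(_ isT).
have move_feasible (u : I -> R) t : \sum_k u k = 0 ->
    (forall d, \sum_k u k * a d k = 0) -> (forall k, 0 <= w k + t * u k) ->
    feasible_weights (fun k => w k + t * u k).
  move=> u1 ua wu; split=> // [|d].
    by rewrite big_split/= w1 -mulr_sumr u1 mulr0 addr0.
  under eq_bigr do rewrite mulrDl -mulrA.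
  by rewrite big_split/= -mulr_sumr ua mulr0 addr0.
have [|t t0 [wt ct]] := move_to_boundary w0 wv.
  by apply: ex_lt0 => //; exists k0.
have [||s s0 [wu cu]] := @move_to_boundary w (fun k => - v k) w0.
- by move=> k /wv ->; rewrite oppr0.
- apply: ex_lt0; first by exists k0; rewrite oppr_eq0.
  by rewrite sumrN v1 oppr0.
have f1 := move_feasible _ _ v1 va wt.
have f2 : feasible_weights (fun k => w k + s * - v k).
  apply: move_feasible => // [|d]; first by rewrite sumrN v1 oppr0.
  by under eq_bigr do rewrite mulNr; rewrite sumrN va oppr0.
have st0 : 0 < s + t by rewrite addr_gt0.
(* With coefficient [s / (s + t)] the displacements [t * v k] and [- s * v k] cancel. *)
have -> : w = (fun k => s / (s + t) * (w k + t * v k) +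
    (1 - s / (s + t)) * (w k + s * - v k)).
  apply/funext => k; field; exact: lt0r_neq0.
apply: Pconv => //.
- apply/andP; split; first by rewrite divr_ge0// ltW.
  by rewrite ler_pdivrMr// mul1r lerDl ltW.
- by apply: IH => //; exact: leq_trans ct _.
- by apply: IH => //; exact: leq_trans cu _.
Qed.

End support_reduction.

(** * Reduction in one factor *)

Lemma expectation_le0P d (T : measurableType d) (R : realType)
    (mu : probability T R) (g : T -> R) :
  expectation_le0 mu g <->
  mu.-integrable [set: T] (EFin \o g) /\ \int[mu]_x g x <= 0.
Proof.
rewrite /expectation_le0 expectation.unlock /Rintegral.
split=> -[ig g0]; split=> //; move: g0; have := integrable_fin_num measurableT ig.
  by move=> /fineK <-; rewrite lee_fin.
by move=> /fineK gE; rewrite -[X in (X <= _)%E]gE lee_fin.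
Qed.

Section one_factor.
Context (R : realType) (T : ptopologicalType).
Local Notation P := (weak_prob R T).
Local Notation prob mu := (mu : probability (borel T) R).

(** Weights are strictly positive so that a nonnegative function with integral 0 under [mu] has
    integral 0 under each component. The index is any finite type, which lets families of different
    origin be joined as a sum type. *)
Definition exactly_representable (U : set P) (mu : P) : Prop :=
  forall (I : finType) (F : I -> T -> R),
    (forall i, (prob mu).-integrable setT (EFin \o F i : borel T -> \bar R)) ->
  exists K (w : 'I_K -> R) (u : 'I_K -> P),
    [/\ forall k, 0 < w k /\ U (u k), \sum_k w k = 1,
        forall k i, (prob (u k)).-integrable setT (EFin \o F i : borel T -> \bar R) &
        forall i, \sum_k w k * \int[prob (u k)]_x F i x = \int[prob mu]_x F i x].

Definition mixture_closed (A : set P) : Prop :=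
  forall K (w : 'I_K -> R) (u : 'I_K -> P) (mu : P),
    (forall k, 0 <= w k) -> \sum_k w k = 1 -> (forall k, A (u k)) ->
    is_mixture w (fun k => u k) mu -> A mu.

(** [mixtures] asks for exactly [n.+1] terms: the nonzero weights are listed first and the remaining
    slots get weight 0 with the default generator [u k0], whence [0 < K]. *)
Lemma small_support_mixtures (U : set P) n K (w : 'I_K -> R) (u : 'I_K -> P)
    (mu : P) :
  (forall k, 0 <= w k) -> (forall k, U (u k)) -> (0 < K)%N ->
  (#|nonzeros w| <= n.+1)%N -> is_mixture w (fun k => u k) mu -> mixtures n U mu.
Proof.
move=> w0 Uu K0 wn muE; pose k0 := Ordinal K0.
pose s := enum (nonzeros w); pose e i := nth k0 s i.
exists (fun i => if (i < size s)%N then w (e i) else 0), (fun i => u (e i)).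
split=> // [k|B mB]; first by case: ifP.
rewrite muE// (bigID (mem (nonzeros w)))/= [X in (_ + X)%E]big1 ?adde0; last first.
  by move=> k; rewrite /nonzeros inE negbK => /eqP ->; rewrite mul0e.
rewrite -big_enum/= (big_nth k0) big_mkord -/s.
rewrite (big_ord_widen_cond n.+1 predT (fun i => (w (e i))%:E * u (e i) B)%E).
  by rewrite big_mkcond/=; apply: eq_bigr => k _; case: ifP => // _; rewrite mul0e.
by rewrite /s -cardE.
Qed.

Context (base U : set P).
Hypotheses (base_mix : mixture_closed base) (Ubase : U `<=` base)
  (rep : forall mu, base mu -> exactly_representable U mu).
Context (M : nat) (phi : 'I_M -> T -> R).
Hypothesis (mphi : forall j, measurable_fun [set: borel T] (phi j)).

Let A : set P := [set mu | base mu /\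
  forall j, expectation_le0 (prob mu) (phi j : borel T -> R)].

(** [C] abstracts the constraints on the product measure as conditions on one marginal. In the
    application [chi] consists of the section integrals, [L] of the section norms, and [E] is the
    set where some section is not integrable. *)
Context (N l : nat) (chi : 'I_N -> T -> R) (L : 'I_l -> T -> R) (E : set (borel T))
  (C : set P).
Hypotheses (mchi : forall j, measurable_fun [set: borel T] (chi j))
  (mL : forall j, measurable_fun [set: borel T] (L j)) (mE : measurable E).
Hypothesis Cchi : forall nu : P,
  (forall j, (prob nu).-integrable setT (EFin \o chi j : borel T -> \bar R)) ->
  (forall j, (prob nu).-integrable setT (EFin \o L j : borel T -> \bar R)) ->
  prob nu E = 0%E ->
  (forall j, \int[prob nu]_x chi j x <= 0) -> C nu.

(* The indicator of the null set E is added to the test functions: every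
   component of the resulting mixture is forced to give E mass 0. *)
Lemma one_factor_reduction (g : P -> R) (mu : P) (c : R) :
  quasi_convex_on A g -> lower_semicontinuous_on A g -> A mu ->
  (forall j, (prob mu).-integrable setT (EFin \o chi j : borel T -> \bar R)) ->
  (forall j, (prob mu).-integrable setT (EFin \o L j : borel T -> \bar R)) ->
  prob mu E = 0%E ->
  (forall j, \int[prob mu]_x chi j x <= 0) ->
  c < g mu ->
  exists nu : P, [/\ A nu, mixtures (M + N) U nu, C nu & c < g nu].
Proof.
move=> qc lsc Amu ichi iL muE0 chi0 cg.
apply: contrapT => nex.
have small nu : A nu -> mixtures (M + N) U nu -> C nu -> g nu <= c.
  move=> Anu mixnu Cnu; rewrite leNgt; apply/negP => cnu.
  by apply: nex; exists nu.
have [V Vmu Vg] : exists2 V, nbhs (mu : subspace A) V & forall nu, V nu -> c < g nu.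
  by have [|V mV VP] := lsc mu c; rewrite ?lte_fin//; exists V.
have {}Vmu : within A (nbhs (mu : P)) V by rewrite (nbhs_subspace_in Amu).
have [n [b [bc bV]]] := weak_prob_nbhs Vmu.
have [bmu Ephi] := Amu.
pose F (i : 'I_M + 'I_N + 'I_l + unit + 'I_n) : T -> R := match i with
  | inl (inl (inl (inl j))) => phi j
  | inl (inl (inl (inr j))) => chi j
  | inl (inl (inr j)) => L j
  | inl (inr _) => \1_E
  | inr j => b j
  end.
have [] := rep bmu (F := F).
  move=> [[[[]|]|]|]/=.
  - by move=> j; have [] := Ephi j.
  - exact: ichi.
  - exact: iL.
  - by move=> _; apply: integrable_indic.
  - by move=> j; exact: bounded_continuous_integrable.
move=> K [w [u [wU w1 iu intu]]].
have w0 k : 0 <= w k by have [/ltW] := wU k.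
have Uu k : U (u k) by have [] := wU k.
have K0 : (0 < K)%N.
  case: {+}K w w1 {w0 iu intu wU} => // w; rewrite big_ord0 => /eqP.
  by rewrite eq_sym oner_eq0.
have intE (nu : P) : \int[prob nu]_x (\1_E x : R) = fine (prob nu E).
  by rewrite /Rintegral integral_indic// setIT.
have uE k : prob (u k) E = 0%E.
  have := intu (inl (inr tt)); rewrite /= intE muE0/= => /eqP.
  rewrite psumr_eq0 => [/allP/(_ k)|j _]; last first.
    by rewrite mulr_ge0// intE fine_ge0.
  rewrite mem_index_enum mulf_eq0 intE => /(_ isT)/orP[|/eqP uE0].
    by have [/gt_eqF ->] := wU k.
  by rewrite -[LHS]fineK ?uE0 ?fin_num_measure.
(* Only these [M + N] functions restrict the weights, which fixes the number of generators.
   Integrability of [L] and nullity of [E] hold for each [u k], hence under any weights, and the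
   [b k] matter only for the initial weights [w]. *)
pose a (d : 'I_M + 'I_N) k :=
  \int[prob (u k)]_x F (inl (inl (inl d))) x.
pose rowf (d : 'I_M + 'I_N) := F (inl (inl (inl d))).
have mrowf d : measurable_fun [set: borel T] (rowf d) by case: d.
have fA v (nu : P) : feasible_weights a v -> is_mixture v (fun k => u k) nu ->
    A nu /\ C nu.
  move=> [v0 v1 va] nuE.
  have vrow d : \int[prob nu]_x rowf d x <= 0.
    rewrite (Rintegral_mixture v0 nuE (mrowf d)) => [|k]; last exact: iu.
    exact: va.
  have irow i : measurable_fun [set: borel T] (F i) ->
      (prob nu).-integrable setT (EFin \o F i : borel T -> \bar R).
    move=> mF; apply: (integrable_mixture v0 nuE mF) => k; exact: iu.
  split.
    split; first exact: (base_mix v0 v1 (fun k => Ubase (Uu k)) nuE).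
    move=> j; apply/expectation_le0P; split; last exact: (vrow (inl j)).
    exact: (irow (inl (inl (inl (inl j)))) (mphi j)).
  apply: Cchi.
  - by move=> j; exact: (irow (inl (inl (inl (inr j)))) (mchi j)).
  - by move=> j; exact: (irow (inl (inl (inr j))) (mL j)).
  - by rewrite nuE// big1// => k _; rewrite [X in (_ * X)%E]uE mule0.
  - by move=> j; exact: (vrow (inr j)).
(* Under the contradiction hypothesis [g] is at most [c] on feasible mixtures of small support, and
   quasi-convexity spreads this bound to all feasible weights. *)
have gle : forall v, feasible_weights a v ->
    forall nu : P, is_mixture v (fun k => u k) nu -> g nu <= c.
  apply: feasible_weights_ind.
  - move=> v fv vs nu nuE; have [Anu Cnu] := fA _ _ fv nuE; apply: small => //.
    apply: (small_support_mixtures _ Uu K0 _ nuE); first by case: fv.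
    by rewrite card_sum !card_ord in vs.
  - move=> v1 v2 t f1 f2 t01 IH1 IH2 nu nuE.
    have [v1_ge0 v1_1 _] := f1; have [v2_ge0 v2_1 _] := f2.
    have [nu1 nu1E] := exists_mixture (fun k => prob (u k)) v1_ge0 v1_1.
    have [nu2 nu2E] := exists_mixture (fun k => prob (u k)) v2_ge0 v2_1.
    have fv : feasible_weights a (fun k => t * v1 k + (1 - t) * v2 k).
      have [_ _ v1a] := f1; have [_ _ v2a] := f2.
      have /andP[t0 t1] := t01.
      split=> [k||d].
      - by rewrite addr_ge0// mulr_ge0// subr_ge0.
      - by rewrite big_split/= -!mulr_sumr v1_1 v2_1 !mulr1 addrC subrK.
      - under eq_bigr do rewrite mulrDl -!mulrA.
        rewrite big_split/= -!mulr_sumr.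
        rewrite -[leRHS]addr0; apply: lerD; apply: mulr_ge0_le0 => //.
        by rewrite subr_ge0.
    apply: (@le_trans _ _ (Num.max (g nu1) (g nu2))); last first.
      by rewrite ge_max IH1// IH2.
    apply: (qc nu1 nu2 nu t) => //.
    + by case: (fA _ _ f1 nu1E).
    + by case: (fA _ _ f2 nu2E).
    + by case: (fA _ _ fv nuE).
    + move=> B mB; rewrite nu1E// nu2E// nuE//.
      have uB k : u k B = (fine (prob (u k) B))%:E by rewrite fineK// fin_num_measure.
      under eq_bigr do rewrite uB -EFinM.
      under [X in (_ = _ * X + _)%E]eq_bigr do rewrite uB -EFinM.
      under [X in (_ = _ + _ * X)%E]eq_bigr do rewrite uB -EFinM.
      rewrite !sumEFin -!EFinM -EFinD; congr EFin.
      rewrite !mulr_sumr -big_split/=; apply: eq_bigr => k _.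
      by rewrite mulrDl !mulrA.
have [nu nuE] := exists_mixture (fun k => prob (u k)) w0 w1.
have fw : feasible_weights a w.
  split=> // d.
  rewrite [leLHS](intu (inl (inl (inl d)))); case: d => j /=; last exact: chi0.
  by have /expectation_le0P[] := Ephi j.
have [Anu Cnu] := fA _ _ fw nuE.
(* The mixture with the initial weights has the same integrals of the [b k] as [mu], so it lies in
   the neighbourhood where [g] exceeds [c]. *)
have := gle w fw nu nuE; rewrite leNgt => /negP; apply.
apply: Vg; apply: bV Anu => k.
rewrite -(intu (inr k)) (Rintegral_mixture w0 nuE)//.
- have /integrableP[/measurable_EFinP mb _] :=
    bounded_continuous_integrable (prob mu) (bc k).
  exact: mb.
- by move=> i; exact: (iu i (inr k)).
Qed.

End one_factor.

(** * Integration along one coordinate of a product *)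

Section disintegration.
Context (R : realType) (I : finType) (d : I -> measure_display)
  (T : forall i, measurableType (d i)) (mu : forall i, probability (T i) R).
Local Notation X := (prod_space T).

Definition rectangles : set (set X) := [set C | exists2 B : forall i, set (T i),
  (forall i, measurable (B i)) & C = [set x | forall i, B i (x i)]].

Lemma measurable_rectanglesE : (@measurable _ X) = <<s rectangles >>.
Proof.
apply/seteqP; split.
  apply: smallest_sub; first exact: smallest_sigma_algebra.
  move=> _ [i [B mB ->]]; apply: sub_sigma_algebra.
  exists (dfwith (fun j => [set: T j]) i B).
    by move=> j; case: dfwithP.
  apply/seteqP; split=> x /= Bx => [j|]; first by case: dfwithP.
  by have := Bx i; rewrite dfwithin.
apply: smallest_sub; first exact: sigma_algebra_measurable.
by move=> _ [B mB ->]; exact: measurable_rectangle.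
Qed.

Lemma rectangles_setI_closed : setI_closed rectangles.
Proof.
move=> _ _ [A mA ->] [B mB ->]; exists (fun i => A i `&` B i).
  by move=> i; exact: measurableI.
apply/seteqP; split=> x /=; first by move=> [Ax Bx] i.
by move=> ABx; split=> i; have [] := ABx i.
Qed.

Definition draw_coord i (nu : probability (T i) R) : probability X R :=
  distribution (nu \x prod_prob mu)%E (@set_coord _ _ T i).

(** Isolates one marginal: the law becomes an image of [nu \x prod_prob mu], to which Fubini
    applies. Both sides agree on rectangles, a pi-system; the old draw of coordinate [i] is
    overwritten, so it only contributes the factor 1. *)
Lemma prod_prob_dfwith i (nu : probability (T i) R) (B : set X) :
  measurable B -> prod_prob (dfwith mu i nu) B = draw_coord nu B.
Proof.
apply: (measure_unique rectangles (fun=> setT)).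
- exact: measurable_rectanglesE.
- exact: rectangles_setI_closed.
- by move=> _; exists (fun=> setT) => //; apply/seteqP; split.
- by rewrite bigcup_const.
- move=> _ [C mC ->]; rewrite [LHS](prod_prob_rectangle _ mC).
  pose C' := dfwith C i setT.
  have mC' j : measurable (C' j) by rewrite /C'; case: dfwithP.
  transitivity ((nu \x prod_prob mu)%E (C i `*` [set x | forall j, C' j (x j)])).
    rewrite product_measure1E//; last exact: measurable_rectangle.
    rewrite [X in (_ = _ * X)%E](prod_prob_rectangle mu mC').
    rewrite (bigD1 i)//= dfwithin; congr (_ * _)%E.
    rewrite [RHS](bigD1 i)//= /C' dfwithin probability_setT mul1e.
    by apply: eq_bigr => j ji; rewrite !dfwithout// eq_sym.
  rewrite /draw_coord/= /distribution /pushforward; congr (_ _).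
  apply/seteqP; split=> -[x g] /=.
    move=> [Cx Cg] j; rewrite /set_coord.
    have [<-|ij] := eqVneq i j; first by rewrite dfwithin.
    by rewrite dfwithout//; have := Cg j; rewrite /C' dfwithout.
  move=> Cg; split=> [|j]; first by have := Cg i; rewrite /set_coord dfwithin.
  rewrite /C'; have [<-|ij] := eqVneq i j; first by rewrite dfwithin.
  by rewrite dfwithout//; have := Cg j; rewrite /set_coord dfwithout.
- by move=> _; rewrite [X in (X < _)%E](probability_setT (prod_prob (dfwith mu i nu))) ltry.
Qed.

Section section_integrals.
Context (i : I) (Phi : X -> R).
Hypothesis mPhi : measurable_fun setT Phi.
Local Notation Q := (prod_prob mu).

Let Psi (z : T i * X) := Phi (set_coord z).

Let mPsi : measurable_fun setT Psi.
Proof. by apply: measurableT_comp => //; exact: measurable_set_coord. Qed.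

Let absint x := (\int[Q]_y `|(Psi (x, y))%:E|)%E.

(** [fine] sends [+oo] to 0, so [section_norm] is blind to sections with infinite norm;
    [bad_sections] records them separately. *)
Definition bad_sections : set (T i) := [set x | absint x = +oo%E].
Definition section_norm (x : T i) : R := fine (absint x).
Definition section_int (x : T i) : R := \int[Q]_y Psi (x, y).

Let mabsint : measurable_fun setT absint.
Proof.
apply: (measurable_fun_fubini_tonelli_F (m2 := Q) (fun z => `|(Psi z)%:E|%E)) => //.
by do 2 apply: measurableT_comp => //.
Qed.

Lemma measurable_bad_sections : measurable bad_sections.
Proof.
rewrite -[X in measurable X]setTI.
have := mabsint measurableT (emeasurable_set1 +oo%E).
by rewrite setTI /bad_sections.
Qed.

Lemma measurable_section_norm : measurable_fun setT section_norm.
Proof. by apply: measurableT_comp => //; exact: fine_measurable. Qed.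

Lemma measurable_section_int : measurable_fun setT section_int.
Proof.
have pos (G : T i * X -> \bar R) : measurable_fun setT G ->
    (forall z, 0 <= G z)%E -> measurable_fun setT (fun x => (\int[Q]_y G (x, y))%E).
  by move=> mG G0; exact: (measurable_fun_fubini_tonelli_F (m2 := Q) G).
have mEPsi : measurable_fun setT (EFin \o Psi) by exact/measurable_EFinP.
apply: measurableT_comp; first exact: fine_measurable.
rewrite (_ : (fun x => _) = (fun x => \int[Q]_y (EFin \o Psi)^\+ (x, y))%E \-
    (fun x => \int[Q]_y (EFin \o Psi)^\- (x, y))%E)%E.
  apply: emeasurable_funB.
    exact: (pos _ (measurable_funepos mEPsi) (funepos_ge0 _)).
  exact: (pos _ (measurable_funeneg mEPsi) (funeneg_ge0 _)).
apply/funext => x; rewrite [LHS]integralE.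
by congr (_ - _)%E; apply: eq_integral => y _; rewrite ?funeposE ?funenegE.
Qed.

Variable nu : probability (T i) R.
Local Notation P := (prod_prob (dfwith mu i nu)).

Let absPhi : (\int[P]_x `|(Phi x)%:E| = \int[nu]_x absint x)%E.
Proof.
rewrite (eq_measure_integral (draw_coord nu)); last first.
  by move=> B mB _; exact: prod_prob_dfwith.
rewrite ge0_integral_distribution//=.
  rewrite fubini_tonelli1//.
  by do 2 apply: measurableT_comp => //.
by do 2 apply: measurableT_comp => //.
Qed.

(** By Tonelli the integral of [|Phi|] is the [nu]-integral of [absint], which is finite exactly
    when [absint] is almost everywhere finite and its real-valued version is integrable.
    Integrability on the product thus becomes a condition that a finite mixture can be made to
    satisfy. *)
Lemma integrable_sections : P.-integrable setT (EFin \o Phi) <->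
  nu bad_sections = 0%E /\ nu.-integrable setT (EFin \o section_norm).
Proof.
have abs0 x : (0 <= absint x)%E by exact: integral_ge0.
have mabsPhi : measurable_fun setT (EFin \o Phi) by exact/measurable_EFinP.
split=> [/integrableP[_]|[bad0 inorm]].
  rewrite absPhi => fin.
  have iabs : nu.-integrable setT absint.
    apply/integrableP; split=> //.
    by under eq_integral do rewrite gee0_abs//.
  have bad0 : nu bad_sections = 0%E.
    have := integrable_ae measurableT iabs.
    move=> [N [mN N0 BN]]; apply/eqP; rewrite eq_le measure_ge0 andbT -N0.
    apply: le_measure; rewrite ?inE//; first exact: measurable_bad_sections.
    move=> x Bx; apply: BN => /= /(_ Logic.I).
    by rewrite (_ : absint x = +oo%E).
  split=> //; apply: (le_integrable measurableT) iabs => //.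
    by apply/measurable_EFinP; exact: measurable_section_norm.
  move=> x _; rewrite !gee0_abs/= ?lee_fin ?fine_ge0// /section_norm.
  by case: (absint x) (abs0 x) => //= _; exact: leey.
apply/integrableP; split=> //; rewrite absPhi.
have -> : (\int[nu]_x absint x = \int[nu]_x `|(section_norm x)%:E|)%E.
  apply: ge0_ae_eq_integral => //.
    apply: measurableT_comp => //; apply/measurable_EFinP.
    exact: measurable_section_norm.
  exists bad_sections; split=> //; first exact: measurable_bad_sections.
  move=> x /= nx; rewrite /bad_sections/=; apply: contrapT => xoo; apply: nx => _.
  rewrite /section_norm /= ger0_norm ?fine_ge0// fineK// ge0_fin_numE//.
  by rewrite ltey; apply/eqP.
by have /integrableP[] := inorm.
Qed.

(** Fubini; [section_int] agrees with the extended section integral only where the latter is finite,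
    that is almost everywhere. *)
Lemma Rintegral_sections : P.-integrable setT (EFin \o Phi) ->
  nu.-integrable setT (EFin \o section_int) /\
  \int[P]_x Phi x = \int[nu]_x section_int x.
Proof.
move=> iPhi.
have iPsi : (nu \x Q)%E.-integrable setT (EFin \o Psi).
  apply/integrableP; split; first exact/measurable_EFinP.
  have /integrableP[_] := iPhi; rewrite absPhi fubini_tonelli1//.
  by do 2 apply: measurableT_comp => //.
have aefin : {ae nu, forall x, (\int[Q]_y (Psi (x, y))%:E)%E \is a fin_num}.
  have := ae_integrable1 iPsi; apply: filterS => x.
  exact: integrable_fin_num.
have := integrable_fubini_F iPsi; rewrite /fubini_F/= => iF.
have aeE : {ae nu, forall x, setT x ->
    (\int[Q]_y (Psi (x, y))%:E)%E = (section_int x)%:E}.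
  by apply: filterS aefin => x xfin _; rewrite fineK.
have msec : measurable_fun setT (EFin \o section_int).
  by apply/measurable_EFinP; exact: measurable_section_int.
split.
  have /integrableP[mF] := iF.
  rewrite (_ : (\int[nu]_x `|_| = \int[nu]_x `|(section_int x)%:E|)%E).
    by move=> fin; apply/integrableP.
  apply: ae_eq_integral => //; try exact: measurableT_comp.
  by apply: filterS aeE => x /(_ Logic.I) + _ => ->.
congr fine; rewrite (eq_measure_integral (draw_coord nu)); last first.
  by move=> B mB _; exact: prod_prob_dfwith.
rewrite integral_distribution//; last exact/measurable_EFinP.
rewrite -(integral12_prod_meas1 iPsi); apply: ae_eq_integral => //.
by case/integrableP: iF.
Qed.

End section_integrals.
End disintegration.

(** * Densities from difference quotients *)

Section restriction.
Context d (T : measurableType d) (R : realType).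

Lemma ge0_integral_mrestr (m : {measure set T -> \bar R}) (D : set T)
    (mD : measurable D) (f : T -> \bar R) :
  measurable_fun setT f -> (forall x, 0 <= f x)%E ->
  (\int[mrestr m mD]_x f x = \int[m]_(x in D) f x)%E.
Proof.
move=> mf f0; transitivity (\int[mrestr m mD]_(x in D) f x)%E; last first.
  apply: eq_measure_integral => A mA AD; change (m (A `&` D) = m A).
  by rewrite (setIidl AD).
transitivity (\int[mrestr m mD]_(x in setT `\` ~` D) f x)%E; last first.
  by rewrite setTD setCK.
apply: ge0_negligible_integral => //.
- exact: measurableC.
- by change (m (~` D `&` D) = 0%E); rewrite setICl measure0.
Qed.

Lemma measurable_ltr_set (f g : T -> R) :
  measurable_fun setT f -> measurable_fun setT g ->
  measurable [set x | f x < g x].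
Proof.
move=> mf mg; rewrite -[X in measurable X]setTI.
exact: (measurable_fun_ltr mf mg measurableT (Y := [set true])).
Qed.

Lemma measurable_ler_set (f g : T -> R) :
  measurable_fun setT f -> measurable_fun setT g ->
  measurable [set x | f x <= g x].
Proof.
move=> mf mg; rewrite -[X in measurable X]setTI.
exact: (measurable_fun_ler mf mg measurableT (Y := [set true])).
Qed.

End restriction.

Section density.
Context (R : realType) (m : probability (measurableTypeR R) R).
Local Notation lambda := (@lebesgue_measure R).

(** The difference quotient at [s], with step [1/(n+1)], of the distribution function of [m]. *)
Definition slope_prob n (s : R) : \bar R :=
  (n.+1%:R%:E * m `]s, (s + n.+1%:R^-1)%R]%classic)%E.

Definition right_density (s : R) : \bar R := limn (slope_prob ^~ s).

Let window (x y : R) n : set (measurableTypeR R * measurableTypeR R) :=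
  [set z | (x < z.1 <= y) && (z.1 < z.2 <= z.1 + n.+1%:R^-1)].

Let mwindow x y n : measurable (window x y n).
Proof.
rewrite (_ : window x y n = [set z | x < z.1] `&` [set z | z.1 <= y] `&`
  ([set z | z.1 < z.2] `&` [set z | z.2 <= z.1 + n.+1%:R^-1])).
  apply: measurableI; apply: measurableI.
  - exact: measurable_ltr_set.
  - exact: measurable_ler_set.
  - exact: measurable_ltr_set.
  - by apply: measurable_ler_set => //; exact: measurable_funD.
apply/seteqP; split=> z; rewrite /window /=.
  by move=> /andP[/andP[? ?] /andP[? ?]].
by move=> [[xz zy] [z12 z2]]; rewrite xz zy z12 z2.
Qed.

Lemma measurable_slope_prob n : measurable_fun setT (slope_prob n).
Proof.
apply: emeasurable_funM => //.
pose A : set (measurableTypeR R * measurableTypeR R) :=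
  [set z | z.1 < z.2] `&` [set z | z.2 <= z.1 + n.+1%:R^-1].
have mA : measurable A.
  apply: measurableI; first exact: measurable_ltr_set.
  by apply: measurable_ler_set => //; exact: measurable_funD.
rewrite (_ : (fun s => _) = m \o xsection A).
  exact: measurable_fun_xsection.
apply/funext => s /=; congr (m _); apply/seteqP; split=> u /=.
  by rewrite /xsection/= in_itv/= inE => /andP.
by rewrite /xsection/= in_itv/= inE => -[-> ->].
Qed.

(* Tonelli: both sides integrate the indicator of the window. *)
Lemma integral_slope_prob x y n :
  (\int[lambda]_(s in `]x, y]) slope_prob n s =
   \int[m]_u (n.+1%:R%:E * lambda (ysection (window x y n) u)))%E.
Proof.
rewrite [RHS]ge0_integralZl//; last exact: measurable_fun_ysection.
rewrite [LHS]integral_mkcond.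
transitivity (n.+1%:R%:E * \int[lambda]_s m (xsection (window x y n) s))%E.
  rewrite -ge0_integralZl//; last exact: measurable_fun_xsection.
  apply: eq_integral => s _; rewrite /patch mem_setE/=.
  case: ifPn => [xsy|/negP xsy]; last first.
    rewrite (_ : xsection _ _ = set0) ?measure0 ?mule0//.
    apply/seteqP; split=> // u; rewrite /xsection/= inE => /andP[? _].
    by apply: xsy; rewrite in_itv.
  congr (_ * m _)%E; apply/seteqP; split=> u /=.
    rewrite /xsection/= inE /window/= in_itv/= => ->; rewrite andbT.
    by move: xsy; rewrite in_itv.
  by rewrite /xsection/= inE /window/= in_itv/= => /andP[].
congr (_ * _)%E; transitivity ((lambda \x^ m)%E (window x y n)) => //.
rewrite -[LHS]/((lambda \x m)%E _); apply: product_measure_unique => // A B mA mB.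
by rewrite [LHS]product_measure2E.
Qed.

(** After Tonelli the integrand at [u] is the fraction of [[u - 1/(n+1), u[] lying in []x, y]]. It
    is at most 1 and eventually equal to the indicator of []x, y]], so dominated convergence
    applies. *)
Lemma cvg_integral_slope_prob x y :
  (\int[lambda]_(s in `]x, y]) slope_prob n s)%E @[n --> \oo] --> m `]x, y]%classic.
Proof.
under eq_fun do rewrite integral_slope_prob.
have h0 n : 0 < n.+1%:R^-1 :> R by rewrite invr_gt0.
have secE n u : ysection (window x y n) u = `]x, y] `&` `[u - n.+1%:R^-1, u[.
  apply/seteqP; split=> s; rewrite /ysection/window/= inE/= !in_itv/=.
    by move=> /andP[xsy /andP[su us]]; split=> //; rewrite su lerBlDr us.
  by move=> [-> /andP[us ->]]; rewrite -lerBlDr us.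
have lamE n u : (n.+1%:R%:E * lambda `[(u - n.+1%:R^-1)%R, u[%classic = 1)%E.
  rewrite lebesgue_measure_itv/= lte_fin ltrBlDr ltrDl h0 -EFinB -EFinM.
  by rewrite subKr divff// pnatr_eq0.
have itvE : m `]x, y]%classic = (\int[m]_u (\1_`]x, y] u)%:E)%E.
  by rewrite integral_indic// setIT.
rewrite itvE.
have mf n : measurable_fun setT
    (fun u => n.+1%:R%:E * lambda (ysection (window x y n) u))%E.
  by apply: emeasurable_funM => //; exact: measurable_fun_ysection.
have msec n u : measurable (ysection (window x y n) u) by exact: measurable_ysection.
have [||||| _ _] := @dominated_convergence _ _ _ m setT measurableT
  (fun n u => n.+1%:R%:E * lambda (ysection (window x y n) u))%E
  (EFin \o \1_`]x, y]) (cst 1%E).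
- exact: mf.
- by apply/measurable_EFinP; exact: measurable_indic.
- apply: aeW => u _; rewrite /= indicE mem_setE/= in_itv/=.
  have [ux|xu]/= := leP u x.
    rewrite [X in X @ _](_ : _ = fun=> 0%E); first exact: cvg_cst.
    apply/funext => n; rewrite secE (_ : _ `&` _ = set0) ?measure0 ?mule0//.
    apply/seteqP; split=> // s [] /=; rewrite !in_itv/= => /andP[xs _] /andP[_ su].
    by have := lt_trans (lt_le_trans su ux) xs; rewrite ltxx.
  have [uy|yu] := leP u y.
    apply: cvg_near_cst.
    have ux0 : 0 < u - x by rewrite subr_gt0.
    apply: filterS (near_infty_natSinv_lt (PosNum ux0)) => n /= nux.
    rewrite secE -(lamE n u); congr (_ * lambda _)%E; apply: setIidr => s /=.
    rewrite !in_itv/= => /andP[us su]; rewrite (le_trans (ltW su))// andbT.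
    by rewrite (lt_le_trans _ us)// ltrBrDl -ltrBrDr.
  apply: cvg_near_cst.
  have uy0 : 0 < u - y by rewrite subr_gt0.
  apply: filterS (near_infty_natSinv_lt (PosNum uy0)) => n /= nuy.
  rewrite secE (_ : _ `&` _ = set0) ?measure0 ?mule0//.
  apply/seteqP; split=> // s [] /=; rewrite !in_itv/= => /andP[_ sy] /andP[us _].
  have := le_trans us sy; rewrite lerBlDl -lerBlDr => /le_lt_trans/(_ nuy).
  by rewrite ltxx.
- by apply: finite_measure_integrable_cst.
- apply: aeW => u n _; rewrite gee0_abs ?mule_ge0// -(lamE n u).
  apply: lee_wpmul2l => //; apply: le_measure; rewrite ?inE//.
  by rewrite secE => s [].
- by apply: cvg_trans.
Qed.

(** Two limits of the same integrals: monotone convergence gives the left side,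
    [cvg_integral_slope_prob] the right side. The density is obtained without first proving absolute
    continuity. *)
Lemma integral_right_density a x y :
  (forall s, a < s -> {homo slope_prob ^~ s : i j / (i <= j)%N >-> (i <= j)%E}) ->
  a <= x ->
  (\int[lambda]_(s in `]x, y]) right_density s = m `]x, y]%classic)%E.
Proof.
move=> homop ax.
have : (\int[lambda]_(s in `]x, y]) slope_prob n s)%E @[n --> \oo] -->
    (\int[lambda]_(s in `]x, y]) right_density s)%E.
  apply: cvg_monotone_convergence => //.
  - by move=> n; apply: measurable_funTS; exact: measurable_slope_prob.
  - by move=> n s _; rewrite mule_ge0.
  - move=> s /=; rewrite in_itv/= => /andP[xs _] i j ij.
    by apply: homop => //; exact: le_lt_trans xs.
move=> /cvg_lim <-//; apply/cvg_lim => //.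
exact: cvg_integral_slope_prob.
Qed.

End density.

(** * Change of variables between restricted measures *)

Section transfer.
Context d1 d2 (T1 : measurableType d1) (T2 : measurableType d2) (R : realType).
Context (m1 : {measure set T1 -> \bar R}) (m2 : {measure set T2 -> \bar R})
  (D : set T1) (S : set T2) (f : T2 -> T1).
Hypotheses (mD : measurable D) (mS : measurable S) (mf : measurable_fun setT f)
  (m12 : forall B, measurable B -> m1 (B `&` D) = m2 (f @^-1` B `&` S)).

(** The assumption [m12] says that [f] carries [m2] on [S] to [m1] on [D]. It will be met by the
    projection of a hypograph, by the reflection of the line and by restriction to an interval. *)
Lemma ge0_integral_transfer (F : T1 -> \bar R) :
  measurable_fun setT F -> (forall x, 0 <= F x)%E ->
  (\int[m1]_(x in D) F x = \int[m2]_(x in S) F (f x))%E.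
Proof.
move=> mF F0; rewrite -(ge0_integral_mrestr m1 mD)//.
have mFf : measurable_fun setT (F \o f) by exact: measurableT_comp.
rewrite -(ge0_integral_mrestr m2 mS mFf)//.
rewrite -(ge0_integral_pushforward mf (mrestr m2 mS) (D := setT))//.
  by apply: eq_measure_integral => B mB _; exact: m12.
by move=> x; exact: F0.
Qed.

Lemma integrable_transfer (F : T1 -> R) :
  measurable_fun setT F -> m1.-integrable D (EFin \o F) ->
  m2.-integrable S (EFin \o (F \o f)) /\
  \int[m2]_(x in S) F (f x) = \int[m1]_(x in D) F x.
Proof.
move=> mF iF; have mEF : measurable_fun setT (EFin \o F) by exact/measurable_EFinP.
have iFf : m2.-integrable S (EFin \o (F \o f)).
  apply/integrableP; split.
    by apply: measurable_funTS; apply/measurable_EFinP; exact: measurableT_comp.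
  have /integrableP[_] := iF.
  rewrite (@ge0_integral_transfer (fun x => `|(EFin \o F) x|%E))//.
  exact: measurableT_comp.
split=> //; congr fine; rewrite [LHS]integralE [RHS]integralE.
congr (_ - _)%E.
  rewrite (@ge0_integral_transfer (EFin \o F)^\+%E)//; last exact: measurable_funepos.
  by apply: eq_integral => y _; rewrite !funeposE.
rewrite (@ge0_integral_transfer (EFin \o F)^\-%E)//; last exact: measurable_funeneg.
by apply: eq_integral => y _; rewrite !funenegE.
Qed.

End transfer.

(** * Finite combinations of sections of a product *)

Section fubini_combination.
Context (R : realType) d1 d2 (T1 : measurableType d1) (T2 : measurableType d2)
  (m1 : {sigma_finite_measure set T1 -> \bar R})
  (m2 : {sigma_finite_measure set T2 -> \bar R}).

(** [exists_combination] is applied to the sectional integrals, set to 0 on the null set [N] where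
    some section is not integrable. Points of [N] then contribute nothing and are discarded, so
    integrability holds at every point kept. *)
Lemma exists_section_combination n (f0 : T1 * T2 -> R)
    (f : 'I_n -> T1 * T2 -> R) :
  (m1 \x m2)%E.-integrable setT (EFin \o f0) -> (forall z, 0 <= f0 z) ->
  0 < \int[(m1 \x m2)%E]_z f0 z ->
  (forall i, (m1 \x m2)%E.-integrable setT (EFin \o f i)) ->
  exists s : seq (R * T1),
    [/\ forall c, c \in s -> [/\ 0 < c.1,
          m2.-integrable setT (fun y => (f0 (c.2, y))%:E) &
          forall i, m2.-integrable setT (fun y => (f i (c.2, y))%:E)],
        forall i, \sum_(c <- s) c.1 * \int[m2]_y f i (c.2, y) =
          \int[(m1 \x m2)%E]_z f i z &
        \sum_(c <- s) c.1 * \int[m2]_y f0 (c.2, y) =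
          \int[(m1 \x m2)%E]_z f0 z].
Proof.
move=> if0 f0_ge0 f0_gt0 iff.
have : {ae m1, forall x, m2.-integrable setT (fun y => (f0 (x, y))%:E) /\
    forall i, m2.-integrable setT (fun y => (f i (x, y))%:E)}.
  apply: filterI; first exact: (ae_integrable1 if0).
  exact: (filter_forall (ae_filter_ringOfSetsType m1) (fun i => ae_integrable1 (iff i))).
move=> [N [mN N0 goodN]].
have good x : ~ N x -> m2.-integrable setT (fun y => (f0 (x, y))%:E) /\
    forall i, m2.-integrable setT (fun y => (f i (x, y))%:E).
  by move=> Nx; apply: contrapT => nx; apply: Nx; exact: goodN.
pose sec (g : T1 * T2 -> R) := (fun x => \int[m2]_y g (x, y)) \_ (~` N).
have secP g : (m1 \x m2)%E.-integrable setT (EFin \o g) ->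
    (forall x, ~ N x -> m2.-integrable setT (fun y => (g (x, y))%:E)) ->
    m1.-integrable setT (EFin \o sec g) /\
    \int[m1]_x sec g x = \int[(m1 \x m2)%E]_z g z.
  move=> ig goodg.
  have iF := integrable_fubini_F ig.
  have secE : EFin \o sec g = (fubini_F m2 (EFin \o g)) \_ (~` N).
    apply/funext => x; rewrite /sec /= /patch; case: ifPn => //.
    rewrite inE => Nx; rewrite /Rintegral fineK//.
    exact: (integrable_fin_num measurableT (goodg x Nx)).
  have isec : m1.-integrable setT (EFin \o sec g).
    rewrite secE -integrable_mkcond; last exact: measurableC.
    by apply: integrableS iF => //; exact: measurableC.
  split=> //; congr fine; rewrite -(integral12_prod_meas1 ig).
  apply: ae_eq_integral => //.
  - by case/integrableP: isec.
  - by case/integrableP: iF.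
  - exists N; split=> // x /= nx; apply: contrapT => Nx; apply: nx => _.
    by rewrite -[LHS]/((EFin \o sec g) x) secE /patch mem_set.
have [is0 ints0] := secP _ if0 (fun x Nx => (good x Nx).1).
have isf i := secP _ (iff i) (fun x Nx => (good x Nx).2 i).
have [||||s [s0 sf sf0]] := @exists_combination R n _ T1 m1 (sec f0) (sec \o f).
- exact: is0.
- move=> x; rewrite /sec /patch; case: ifP => // _; exact: Rintegral_ge0.
- by rewrite ints0.
- by move=> i; have [] := isf i.
have sE g : \sum_(c <- [seq c <- s | c.2 \notin N]) c.1 * \int[m2]_y g (c.2, y) =
            \sum_(c <- s) c.1 * sec g c.2.
  rewrite big_filter big_mkcond/=; apply: eq_bigr => c _; rewrite /sec /patch in_setC.
  by case: ifP; rewrite ?mulr0.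
exists [seq c <- s | c.2 \notin N]; split.
- move=> c; rewrite mem_filter => /andP[cN /(allP s0) c0].
  have [if0c ifc] := good c.2 (fun Nc => negP cN (mem_set Nc)).
  by split.
- by move=> i; rewrite sE sf; have [] := isf i.
- by rewrite sE sf0.
Qed.

End fubini_combination.

(** * Layer-cake decomposition of a decreasing density *)

Section initial_interval.
Context (R : realType).
Local Notation lambda := (@lebesgue_measure R).

(** For [a < x], the interval []a, x]] is contained in [I] or contains it, according to whether [x]
    is in [I]; comparing measures places [x] relative to [a + lambda I]. *)
Lemma initial_interval (a : R) (I : set R) : measurable (I : set (measurableTypeR R)) ->
  I `<=` `]a, +oo[ -> (forall x y, a < x -> x <= y -> I y -> I x) ->
  (lambda I < +oo)%E ->
  `]a, (a + fine (lambda I))%R[ `<=` I /\ I `<=` `]a, (a + fine (lambda I))%R].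
Proof.
move=> mI Ia Idown Ifin; set l := fine (lambda I).
have lE : lambda I = l%:E by rewrite fineK// ge0_fin_numE.
have sub x : a < x -> I x -> x <= a + l.
  move=> ax Ix; rewrite -lerBlDl -lee_fin -lE.
  have -> : ((x - a)%:E = lambda `]a, x]%classic)%E.
    by rewrite lebesgue_measure_itv/= lte_fin ax EFinB.
  apply: le_measure; rewrite ?inE//.
  by move=> y /=; rewrite in_itv/= => /andP[ay yx]; exact: Idown Ix.
split=> x; last first.
  by move=> Ix; have := Ia _ Ix; rewrite /= !in_itv/= andbT => ax; rewrite ax sub.
rewrite /= in_itv/= => /andP[ax xl]; apply: contrapT => nIx.
have : (lambda I <= (x - a)%:E)%E.
  have -> : ((x - a)%:E = lambda `]a, x]%classic)%E.
    by rewrite lebesgue_measure_itv/= lte_fin ax EFinB.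
  apply: le_measure; rewrite ?inE//.
  move=> y Iy; have := Ia _ Iy; rewrite /= !in_itv/= andbT => ay; rewrite ay/=.
  by rewrite leNgt; apply/negP => /ltW xy; apply: nIx; exact: Idown Iy.
by rewrite lE lee_fin lerBrDl leNgt xl.
Qed.

End initial_interval.

Section layer_cake.
Context (R : realType) (m : probability (measurableTypeR R) R) (a : R).
Local Notation lambda := (@lebesgue_measure R).
Local Notation RR := (measurableTypeR R).

Hypothesis homo_slope : forall s, a < s ->
  {homo slope_prob m ^~ s : i j / (i <= j)%N >-> (i <= j)%E}.
Hypothesis slope_noninc : forall n s t, a < s -> s <= t ->
  (slope_prob m n t <= slope_prob m n s)%E.

Let p := right_density m \_ `]a, +oo[.

Let cvg_slope s : a < s -> slope_prob m n s @[n --> \oo] --> p s.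
Proof.
move=> as_; rewrite /p /patch mem_set/= ?in_itv/= ?as_//.
apply: ereal_nondecreasing_is_cvgn => i j ij; exact: homo_slope.
Qed.

Let p_ge0 s : (0 <= p s)%E.
Proof.
rewrite /p /patch; case: ifPn => // /set_mem/=; rewrite in_itv/= andbT => as_.
apply: lime_ge.
  by apply: ereal_nondecreasing_is_cvgn => i j ij; exact: homo_slope.
by apply: nearW => n; rewrite mule_ge0.
Qed.

Let p_noninc s t : a < s -> s <= t -> (p t <= p s)%E.
Proof.
move=> as_ st; have at_ := lt_le_trans as_ st.
rewrite -(cvg_lim _ (cvg_slope at_))// -(cvg_lim _ (cvg_slope as_))//.
apply: lee_lim.
- by apply/cvg_ex; exists (p t); exact: cvg_slope.
- by apply/cvg_ex; exists (p s); exact: cvg_slope.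
- by apply: nearW => n; exact: slope_noninc.
Qed.

Let mp : measurable_fun setT p.
Proof.
have mD : measurable (`]a, +oo[%classic : set RR) by exact: measurable_itv.
apply: (measurable_restrictT (right_density m) mD).1.
apply: (emeasurable_fun_cvg (slope_prob m)).
- by move=> n; apply: measurable_funTS; exact: measurable_slope_prob.
- move=> s /=; rewrite in_itv/= andbT => as_.
  by apply: ereal_nondecreasing_is_cvgn => i j ij; exact: homo_slope.
Qed.

(* The height is the first coordinate.  As the density is nonincreasing, the
   section at height t is, up to its right end, an interval ]a, z[: integrating
   over t exhibits m on ]a, +oo[ as a mixture of uniform laws. *)
Definition hypograph : set (RR * RR) :=
  [set z | 0 < z.1 /\ (z.1%:E < p z.2)%E].

Lemma measurable_hypograph : measurable hypograph.
Proof.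
rewrite (_ : hypograph = [set z | 0 < z.1] `&` [set z | (z.1%:E < p z.2)%E])//.
apply: measurableI; first exact: measurable_ltr_set.
rewrite -[X in measurable X]setTI; apply: measurable_lte => //.
  exact: measurableT_comp.
exact: measurableT_comp.
Qed.

(** At fixed [s] the heights fill []0, p s[], of length [p s], so Tonelli gives the integral of the
    density. Half-open intervals suffice to identify the measures. *)
Lemma hypograph_measure (B : set RR) : measurable B ->
  (m (B `&` `]a, +oo[) = (lambda \x lambda) (snd @^-1` B `&` hypograph))%E.
Proof.
have mS := measurable_hypograph.
have mD : measurable (`]a, +oo[%classic : set RR) by exact: measurable_itv.
have msnd : measurable_fun setT (snd : RR * RR -> RR) by [].
pose W : {measure set RR -> \bar R} := pushforward (mrestr (lambda \x lambda)%E mS) snd.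
pose mu1 : {measure set RR -> \bar R} := mrestr m mD.
suff H A : measurable A -> mu1 A = W msnd A by exact: H.
have U := @measure_unique _ R RR (@ocitv R) (fun n => `](- n%:R), n%:R]%classic).
move: A; apply: U.
- by [].
- exact: ocitvI.
- by move=> n; exists (- n%:R, n%:R).
- apply/seteqP; split=> // x _; exists (Num.bound `|x|) => //=.
  have := archi_boundP (normr_ge0 x); rewrite in_itv/=.
  by rewrite ltr_norml => /andP[-> /ltW].
- move=> _ [[x y] _ <-]/=.
  transitivity (\int[lambda]_(s in `]x, y]) p s)%E.
    rewrite /p -integral_mkcondr.
    have setE : (`]x, y] `&` `]a, +oo[ = `](Num.max x a), y])%classic.
      apply/seteqP; split=> s /=; rewrite !in_itv/= gt_max ?andbT.
        by move=> [/andP[-> ->] ->].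
      by move=> /andP[/andP[-> ->] ->].
    rewrite [in RHS]setE.
    have := @integral_right_density R m a (Num.max x a) y homo_slope.
    rewrite le_max lexx orbT => /(_ isT) ->.
    change (m (`]x, y] `&` `]a, +oo[)%classic = m `](Num.max x a), y]%classic).
    by rewrite setE.
  change (\int[lambda]_(s in `]x, y]) p s =
    (lambda \x lambda) (snd @^-1` `]x, y]%classic `&` hypograph))%E.
  have mX : measurable (snd @^-1` `]x, y] `&` hypograph).
    apply: measurableI => //; rewrite -[X in measurable X]setTI; exact: msnd.
  transitivity ((lambda \x^ lambda) (snd @^-1` `]x, y]%classic `&` hypograph))%E.
    rewrite [LHS]integral_mkcond; apply: eq_integral => s _.
    transitivity (lambda (ysection (snd @^-1` `]x, y]%classic `&` hypograph) s)) => //.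
    rewrite /patch; case: ifPn => sxy; last first.
      rewrite (_ : ysection _ _ = set0) ?measure0//.
      apply/seteqP; split=> // t; rewrite /ysection/= inE => -[/= sxy' _].
      by move: sxy; rewrite mem_set.
    have secE : ysection (snd @^-1` `]x, y] `&` hypograph) s =
        [set t | 0 < t /\ (t%:E < p s)%E].
      apply/seteqP; split=> t; rewrite /ysection/= inE; first by case.
      by move=> tp; split=> //=; exact: set_mem sxy.
    rewrite secE; case ps: (p s) (p_ge0 s) => [r| |]// r0.
      have -> : [set t | 0 < t /\ (t%:E < r%:E)%E] = `]0, r[%classic.
        apply/seteqP; split=> t /=; rewrite in_itv/= lte_fin; last by move/andP.
        by case=> -> ->.
      rewrite lebesgue_measure_itv/= lte_fin oppr0 adde0; case: ltP => // r0'.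
      by congr EFin; apply/le_anti; rewrite r0' -lee_fin r0.
    (* The density may be infinite at [s]; the heights then form a half-line, of infinite length
       too. *)
    have -> : [set t : R | 0 < t /\ (t%:E < +oo)%E] = `]0, +oo[%classic.
      apply/seteqP; split=> t /=; rewrite in_itv/= ltry andbT; last by split.
      by case.
    by rewrite lebesgue_measure_itv/= ltry.
  apply/esym; apply: product_measure_unique => // A C mA mC.
  by rewrite [LHS]product_measure2E.
- move=> n; apply: (@le_lt_trans _ _ 1%E); last exact: ltry.
  by apply: (probability_le1 m); exact: measurableI.
Qed.

Lemma hypograph_section t : 0 < t -> (lambda (xsection hypograph t) < +oo)%E ->
  let l := fine (lambda (xsection hypograph t)) in
  `]a, (a + l)%R[ `<=` xsection hypograph t /\
  xsection hypograph t `<=` `]a, (a + l)%R].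
Proof.
move=> t0 fin; apply: initial_interval => //.
- exact: measurable_xsection measurable_hypograph.
- move=> s; rewrite /xsection/= inE => -[_ /=].
  rewrite /p /patch; case: ifPn => [/set_mem//|_].
  by rewrite lte_fin => /(lt_trans t0); rewrite ltxx.
- move=> x y ax xy; rewrite /xsection/= !inE => -[_ /= ty]; split=> //=.
  by apply: lt_le_trans ty _; exact: p_noninc.
Qed.

(** Were the tail null, all slopes at [s] would be 0 and so would the density. The point is the
    support: positive mass beyond [s] gives points of [J] beyond [s], which will place the uniform
    laws inside [J]. *)
Lemma hypograph_tail (t s : R) : hypograph (t, s) ->
  a < s /\ (0 < m `]s, +oo[%classic)%E.
Proof.
move=> [/= t0 tp].
have as_ : a < s.
  move: tp; rewrite /p /patch; case: ifPn => [/set_mem/=|_].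
    by rewrite in_itv/= andbT.
  by rewrite lte_fin => /(lt_trans t0); rewrite ltxx.
split=> //; rewrite lt_neqAle measure_ge0 andbT eq_sym; apply/eqP => m0.
have : (p s <= 0)%E.
  rewrite -(cvg_lim _ (cvg_slope as_))//; apply: lime_le.
    by apply/cvg_ex; exists (p s); exact: cvg_slope.
  apply: nearW => n; rewrite /slope_prob.
  have -> : m `]s, s + n.+1%:R^-1]%classic = 0%E.
    apply/eqP; rewrite eq_le measure_ge0 andbT -m0.
    apply: le_measure; rewrite ?inE//; try exact: measurable_itv.
    by move=> u /=; rewrite !in_itv/= andbT => /andP[].
  by rewrite mule0.
by move=> /(lt_le_trans tp); rewrite lte_fin => /(lt_trans t0); rewrite ltxx.
Qed.

End layer_cake.

Section right_half.
Context (R : realType) (m : probability (measurableTypeR R) R) (a : R).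
Local Notation lambda := (@lebesgue_measure R).
Local Notation RR := (measurableTypeR R).

Hypothesis homo_slope : forall s, a < s ->
  {homo slope_prob m ^~ s : i j / (i <= j)%N >-> (i <= j)%E}.
Hypothesis slope_noninc : forall n s t, a < s -> s <= t ->
  (slope_prob m n t <= slope_prob m n s)%E.

Lemma Rintegral_itvoo (I : set RR) (x y : R) (F : R -> R) :
  measurable_fun setT F -> measurable I ->
  `]x, y[ `<=` I -> I `<=` `]x, y] ->
  \int[lambda]_(s in I) F s = \int[lambda]_(s in `]x, y[) F s.
Proof.
move=> mF mI subI Isub; congr fine.
have mEF : measurable_fun setT (EFin \o F) by exact/measurable_EFinP.
rewrite [LHS]integral_mkcond [RHS]integral_mkcond.
apply: ae_eq_integral => //.
- exact: (measurable_restrictT _ mI).1 (measurable_funTS mEF).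
- exact: (measurable_restrictT _ (measurable_itv _)).1 (measurable_funTS mEF).
- exists [set y]; split=> //; first exact: lebesgue_measure_set1.
  move=> s /= ns; apply: contrapT => sy; apply: ns => _.
  rewrite /patch; congr (if _ then _ else _); apply/idP/idP; rewrite !inE => sI.
    have := Isub _ sI; rewrite /= !in_itv/= => /andP[-> sy'].
    by rewrite lt_neqAle sy' andbT; apply/eqP.
  exact: subI.
Qed.

(** The reference function is the indicator of the hypograph, whose section at height [t] integrates
    to the length [l t]. A height of weight [c.1] therefore yields the uniform law on []a, a + l
    c.2[] with weight [c.1 * l c.2]; heights with empty interval are dropped. *)
Lemma right_half n (F : 'I_n -> R -> R) :
  (forall i, measurable_fun setT (F i)) ->
  (forall i, m.-integrable `]a, +oo[ (EFin \o F i)) ->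
  exists s : seq (R * R),
    [/\ forall c, c \in s -> [/\ 0 < c.1, a < c.2,
          forall x, x < c.2 -> (0 < m `]x, +oo[%classic)%E &
          forall i, lambda.-integrable `]a, c.2[ (EFin \o F i)],
        forall i, \sum_(c <- s) c.1 *
            ((c.2 - a)^-1 * \int[lambda]_(x in `]a, c.2[) F i x) =
          \int[m]_(x in `]a, +oo[) F i x &
        \sum_(c <- s) c.1 = fine (m `]a, +oo[%classic)].
Proof.
move=> mF iF.
(* The selection of heights requires the hypograph to have positive measure. *)
have [m0|m_neq0] := eqVneq (m `]a, +oo[%classic) 0%E.
  exists [::]; split=> // [i|]; last by rewrite big_nil m0.
  have mEF : measurable_fun setT (EFin \o F i) by exact/measurable_EFinP.
  by rewrite big_nil /Rintegral null_set_integral//; exact: measurable_funTS mEF.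
have mD : measurable (`]a, +oo[%classic : set RR) by exact: measurable_itv.
have mS := measurable_hypograph homo_slope.
set S := hypograph m a in mS.
have msnd : measurable_fun setT (snd : RR * RR -> RR) by [].
have m12 := hypograph_measure homo_slope.
have tr G : measurable_fun setT G -> m.-integrable `]a, +oo[ (EFin \o G) ->
    (lambda \x lambda)%E.-integrable setT (EFin \o ((G \o snd) \_ S)) /\
    \int[(lambda \x lambda)%E]_z ((G \o snd) \_ S) z =
    \int[m]_(x in `]a, +oo[) G x.
  move=> mG iG; have [iGS GS] := integrable_transfer mD mS msnd m12 mG iG.
  split; last by rewrite -GS -Rintegral_mkcond.
  by rewrite -restrict_EFin -integrable_mkcond.
have i1 : m.-integrable `]a, +oo[ (EFin \o cst 1).
  by apply: finite_measure_integrable_cst.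
have int1 : \int[m]_(x in `]a, +oo[) (cst 1) x = fine (m `]a, +oo[%classic).
  by rewrite Rintegral_cst// mul1r.
have m_gt0 : 0 < fine (m `]a, +oo[%classic).
  rewrite fine_gt0// lt_neqAle eq_sym m_neq0 measure_ge0/=.
  by rewrite (le_lt_trans (probability_le1 m mD))// ltry.
have [tr1 tr1E] := tr (cst 1) (measurable_cst _) i1.
have trF i := tr (F i) (mF i) (iF i).
have [||||s [sP sF s1]] := @exists_section_combination R _ _ RR RR lambda lambda n
    ((cst (1 : R) \o snd : RR * RR -> R) \_ S) (fun i => (F i \o snd) \_ S).
- exact: tr1.
- by move=> z; rewrite /patch; case: ifP.
- by rewrite tr1E int1.
- by move=> i; have [] := trF i.
pose I t : set RR := xsection S t.
have mI t : measurable (I t) by exact: measurable_xsection.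
have secE G t : (fun y => ((G \o snd) \_ S) (t, y)) = (G : RR -> R) \_ (I t).
  by apply/funext => y; rewrite /patch /I mem_xsection.
pose l t := fine (lambda (I t)).
have l_ge0 t : 0 <= l t by exact: fine_ge0.
have Ifin c : c \in s -> (lambda (I c.2) < +oo)%E.
  move=> /sP[_ + _]; move=> /(integrable_fin_num measurableT).
  rewrite [X in X \is a fin_num](_ : _ = lambda (I c.2)).
    by rewrite ge0_fin_numE.
  rewrite -[RHS]mul1e -integral_cst// [RHS]integral_mkcond.
  by apply: eq_integral => y _; rewrite /patch /I mem_xsection; case: ifP.
have It t : 0 < l t -> 0 < t.
  apply: contraTT; rewrite -!leNgt => t0.
  rewrite /l (_ : I t = set0) ?measure0//; apply/seteqP; split=> // y.
  by rewrite /I /xsection/= inE => -[/= /lt_le_trans/(_ t0)]; rewrite ltxx.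
have Iitv c : c \in s -> 0 < l c.2 -> `]a, (a + l c.2)%R[ `<=` I c.2 /\
    I c.2 `<=` `]a, (a + l c.2)%R].
  by move=> cs lc; apply: (hypograph_section homo_slope slope_noninc); [exact: It|exact: Ifin].
have intE G c : measurable_fun setT G -> c \in s ->
    c.1 * \int[lambda]_y ((G \o snd) \_ S) (c.2, y) =
    if 0 < l c.2 then c.1 * l c.2 *
      ((a + l c.2 - a)^-1 * \int[lambda]_(x in `]a, (a + l c.2)%R[) G x) else 0.
  move=> mG cs; rewrite secE -Rintegral_mkcond.
  case: ifPn => lc.
    have [sub1 sub2] := Iitv _ cs lc.
    rewrite (@Rintegral_itvoo _ a (a + l c.2) _ mG (mI _) sub1 sub2).
    by rewrite addrAC subrr add0r mulrA mulfK// gt_eqF.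
  have mEG : measurable_fun setT (EFin \o G) by exact/measurable_EFinP.
  rewrite /Rintegral null_set_integral ?mulr0//; first exact: measurable_funTS mEG.
  have l0 : l c.2 = 0 by apply/le_anti; rewrite l_ge0 leNgt lc.
  by rewrite -[LHS]fineK ?ge0_fin_numE ?Ifin// -/(l c.2) l0.
pose s' := [seq (c.1 * l c.2, a + l c.2) | c <- [seq c <- s | 0 < l c.2]].
have s'E G : measurable_fun setT G ->
    \sum_(c <- s') c.1 * ((c.2 - a)^-1 * \int[lambda]_(x in `]a, c.2[) G x) =
    \sum_(c <- s) c.1 * \int[lambda]_y ((G \o snd) \_ S) (c.2, y).
  move=> mG; rewrite big_map big_filter big_mkcond/=.
  by apply: eq_big_seq => c cs; rewrite intE.
exists s'; split.
- move=> _ /mapP[c + ->]; rewrite mem_filter => /andP[lc cs] /=.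
  have [c0 _ ifc] := sP _ cs; have [sub1 sub2] := Iitv _ cs lc.
  split; first exact: mulr_gt0.
  + by rewrite ltrDl.
  (* [y] lies inside the section and beyond [x], so its tail has positive mass and is contained in
     that of [x]. *)
  + move=> x xl; pose y := (Num.max x a + (a + l c.2)) / 2.
    have ay : Num.max x a < y by rewrite midf_lt// gt_max xl ltrDl.
    have yl : y < a + l c.2 by rewrite midf_lt// gt_max xl ltrDl.
    have : I c.2 y.
      by apply: sub1; rewrite /= in_itv/= yl andbT (le_lt_trans _ ay)// le_max lexx orbT.
    rewrite /I /xsection/= inE => /(hypograph_tail homo_slope)[_].
    move=> /lt_le_trans; apply; apply: le_measure; rewrite ?inE//; try exact: measurable_itv.
    move=> u /=; rewrite !in_itv/= !andbT; apply: le_lt_trans.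
    by apply: le_trans (ltW ay); rewrite le_max lexx.
  + move=> i; apply: (integrableS (mI c.2)) => //.
    have := ifc i; rewrite [in X in _ -> X]integrable_mkcond// restrict_EFin.
    by rewrite -[X in EFin \o X]secE.
- move=> i; apply: etrans (s'E _ (mF i)) _; apply: etrans (sF i) _.
  exact: (trF i).2.
- have := s'E (cst 1) (measurable_cst _).
  rewrite s1 tr1E int1 => <-; apply: eq_big_seq => _ /mapP[c + ->].
  rewrite mem_filter => /andP[lc _] /=.
  have lamE : lambda `]a, (a + l c.2)%R[%classic = (l c.2)%:E.
    by rewrite lebesgue_measure_itv/= lte_fin ltrDl lc -EFinB addrAC subrr add0r.
  rewrite Rintegral_cst// mul1r [X in fine X]lamE/= addrAC subrr add0r mulVf ?mulr1//.
  by rewrite gt_eqF.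
Qed.

End right_half.

(** * Monotonicity of difference quotients of a concave primitive *)

Section concave_slopes.
Context (R : realType) (m : probability (measurableTypeR R) R) (a : R)
  (G : R -> R).
Hypothesis mG : forall x y, a < x -> x <= y ->
  m `]x, y]%classic = (G y - G x)%:E.
Hypothesis concG : forall x y t, a < x -> a < y -> 0 <= t <= 1 ->
  t * G x + (1 - t) * G y <= G (t * x + (1 - t) * y).

Let slopeE n s : a < s ->
  slope_prob m n s = (n.+1%:R * (G (s + n.+1%:R^-1) - G s))%:E.
Proof. by move=> as_; rewrite /slope_prob mG// lerDl. Qed.

(** With [N = n+1 <= K = k+1], the point [s + 1/K] is the convex combination of [s] and [s + 1/N]
    with weights [1 - N/K] and [N/K]. *)
Lemma concave_homo_slope s : a < s ->
  {homo slope_prob m ^~ s : i j / (i <= j)%N >-> (i <= j)%E}.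
Proof.
move=> as_ n k nk; rewrite !slopeE// lee_fin.
set N : R := n.+1%:R; set K : R := k.+1%:R.
have N0 : 0 < N by rewrite ltr0n.
have K0 : 0 < K by rewrite ltr0n.
have NK : N <= K by rewrite ler_nat.
have t01 : 0 <= 1 - N / K <= 1.
  rewrite subr_ge0 ler_pdivrMr// mul1r NK/= lerBlDr lerDl.
  by rewrite divr_ge0// ltW.
have asN : a < s + N^-1 by rewrite (lt_le_trans as_)// lerDl invr_ge0 ltW.
have := concG as_ asN t01.
have -> : (1 - N / K) * s + (1 - (1 - N / K)) * (s + N^-1) = s + K^-1.
  by field; rewrite !gt_eqF.
move=> H; rewrite -(ler_pM2l (_ : 0 < K^-1)) ?invr_gt0// mulKf ?gt_eqF//.
rewrite -subr_ge0 in H; rewrite -subr_ge0; apply: le_trans H _.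
by rewrite le_eqVlt; apply/orP; left; apply/eqP; field; rewrite gt_eqF.
Qed.

(** Both [t] and [s + h] are convex combinations of [s] and [t + h], with the weights [h / w] and
    [1 - h / w] exchanged; adding the two concavity inequalities gives the claim. *)
Lemma concave_slope_noninc n s t : a < s -> s <= t ->
  (slope_prob m n t <= slope_prob m n s)%E.
Proof.
move=> as_ st; have at_ := lt_le_trans as_ st.
rewrite !slopeE// lee_fin ler_pM2l ?ltr0n//.
set h : R := n.+1%:R^-1; have h0 : 0 < h by rewrite invr_gt0 ltr0n.
pose w := t - s + h.
have w0 : 0 < w by rewrite /w; lra.
have r0 : 0 <= h / w by rewrite divr_ge0 ?ltW.
have r1 : h / w <= 1 by rewrite ler_pdivrMr// /w; lra.
have ath : a < t + h by lra.
have H1 : h / w * G s + (1 - h / w) * G (t + h) <= G t.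
  have -> : G t = G (h / w * s + (1 - h / w) * (t + h)).
    by congr G; rewrite /w; field; rewrite -/w gt_eqF.
  by apply: concG => //; rewrite r0.
have H2 : (1 - h / w) * G s + h / w * G (t + h) <= G (s + h).
  have -> : G (s + h) = G ((1 - h / w) * s + (1 - (1 - h / w)) * (t + h)).
    by congr G; rewrite /w; field; rewrite -/w gt_eqF.
  have -> : h / w * G (t + h) = (1 - (1 - h / w)) * G (t + h) by ring.
  by apply: concG => //; rewrite subr_ge0 r1 lerBlDr lerDl.
move: H1 H2; lra.
Qed.

End concave_slopes.

(** * Laws on an interval *)

Lemma uniform_probE (R : realType) (lo hi : R) (lohi : lo < hi)
    (B : set (measurableTypeR R)) : measurable B ->
  (uniform_prob lohi B =
   ((hi - lo)^-1)%:E * lebesgue_measure (B `&` `]lo, hi[%classic))%E.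
Proof.
move=> mB; rewrite /uniform_prob integral_uniform_pdf.
transitivity (\int[lebesgue_measure]_(x in B `&` `[lo, hi]) ((hi - lo)^-1)%:E)%E.
  apply: eq_integral => x; rewrite inE /uniform_pdf => -[_] /=.
  by rewrite in_itv/= => ->.
rewrite integral_cst; last exact: measurableI.
congr (_ * _)%E; apply/eqP; rewrite eq_le; apply/andP; split; last first.
  apply: le_measure; rewrite ?inE//; try exact: measurableI.
  by move=> x [Bx] /=; rewrite !in_itv/= => /andP[/ltW -> /ltW ->].
pose N : set (measurableTypeR R) := [set lo] `|` [set hi].
have mN : measurable N by exact: measurableU.
have N0 : lebesgue_measure N = 0%E.
  by rewrite /N [LHS]measureU0//; exact: lebesgue_measure_set1.
have mBo : measurable (B `&` `]lo, hi[) by exact: measurableI.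
rewrite -(measureU0 mBo mN N0); apply: le_measure; rewrite ?inE//.
- exact: measurableI.
- exact: measurableU.
move=> x [Bx] /=; rewrite in_itv/= => /andP[lox xhi].
have [->|xlo] := eqVneq x lo; first by right; left.
have [->|xhi'] := eqVneq x hi; first by right; right.
by left; split=> //; rewrite /= in_itv/= !lt_neqAle eq_sym xlo lox xhi' xhi.
Qed.

Section itv_space.
Context (R : realType) (J : set R) (a : J).
Hypothesis iJ : is_interval J.
Local Notation X := (itv_space a).
Local Notation RR := (measurableTypeR R).
Local Notation lambda := (@lebesgue_measure R).
Local Notation P := (weak_prob R X).

Lemma measurable_set_val : measurable_fun setT (set_val : borel X -> RR).
Proof.
apply: (measurability _ (RGenOInfty.measurableE R)) => //.
move=> _ [_ [x ->] <-]; rewrite setTI; apply: sub_sigma_algebra.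
by exists `]x, +oo[%classic => //; exact: itv_open.
Qed.

(* The hypothesis is an argument so that the retraction, which is measurable
   only because J is, can carry a canonical structure. *)
Definition itv_retract of is_interval J := fun r : RR =>
  match pselect (J r) with
  | left Jr => exist _ r (mem_set Jr)
  | right _ => a
  end : borel X.

Local Notation ret := (itv_retract iJ).

Lemma itv_retractK r : J r -> set_val (ret r : X) = r.
Proof. by rewrite /itv_retract; case: pselect. Qed.

Lemma set_valK (x : X) : ret (set_val x) = x.
Proof.
apply: val_inj; have Jx : J (set_val x) by exact: set_valP.
exact: itv_retractK.
Qed.

Lemma measurable_itv_retract : measurable_fun setT ret.
Proof.
have mJ : measurable (J : set RR) by exact: is_interval_measurable.
apply: (@measurability _ _ RR (borel X) setT ret (@open X) erefl).
move=> _ [_ [U oU <-] <-]; rewrite setTI.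
rewrite (_ : _ @^-1` _ = (U `&` J) `|` (if `[< U (set_val a) >] then ~` J else set0)).
  apply: measurableU.
    by apply: measurableI => //; exact: open_measurable.
  by case: ifP => _ //; exact: measurableC.
apply/seteqP; split=> r /=.
  have [Jr|nJr] := pselect (J r).
    by move=> Ur; left; split=> //; rewrite -(itv_retractK Jr).
  rewrite /itv_retract; case: pselect => // _ Ua; right.
  by rewrite (asboolT Ua).
move=> [[Ur Jr]|]; first by rewrite /preimage/= itv_retractK.
case: asboolP => //= Ua nJr; rewrite /preimage/= /itv_retract.
by case: pselect.
Qed.

HB.instance Definition _ :=
  isMeasurableFun.Build _ _ _ _ ret measurable_itv_retract.

Section uniform.
Context (lo hi : R) (lohi : lo < hi) (Jlohi : `]lo, hi[ `<=` J).

Definition uniform_on : P := distribution (uniform_prob lohi) ret.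

Lemma uniform_on_line (B : set RR) : measurable B ->
  on_line uniform_on B = uniform_prob lohi B.
Proof.
move=> mB; change (uniform_prob lohi (ret @^-1` ((set_val : X -> R) @^-1` B)) =
  uniform_prob lohi B).
have mp : measurable (ret @^-1` ((set_val : X -> R) @^-1` B)).
  rewrite -[X in measurable X]setTI.
  exact: (measurableT_comp measurable_set_val measurable_itv_retract).
rewrite [LHS](uniform_probE lohi mp) uniform_probE//; congr (_ * lambda _)%E.
apply/seteqP; split=> r /= [Br rlohi]; split=> //.
  by rewrite -(itv_retractK (Jlohi rlohi)).
by rewrite /preimage/= itv_retractK//; exact: Jlohi.
Qed.

Lemma Rintegral_uniform_on (F : X -> R) :
  measurable_fun [set: borel X] F ->
  lambda.-integrable `]lo, hi[ (EFin \o (F \o ret)) ->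
  (uniform_on : probability (borel X) R).-integrable setT (EFin \o F : borel X -> \bar R) /\
  \int[uniform_on : probability (borel X) R]_x F x =
  (hi - lo)^-1 * \int[lambda]_(r in `]lo, hi[) F (ret r).
Proof.
move=> mF iF; pose Fr : RR -> R := F \o ret.
have mFr : measurable_fun setT Fr.
  exact: (measurableT_comp mF measurable_itv_retract).
have mI : measurable (`]lo, hi[%classic : set RR) by exact: measurable_itv.
have [iFm intFm] := integrable_transfer (m2 := mrestr lambda mI) mI measurableT
  (@measurable_id _ RR setT) (fun B mB => esym (congr1 lambda
     (congr1 (setI^~ `]lo, hi[%classic) (setIT B)))) mFr iF.
have c0 : forall k : 'I_1, 0 <= (hi - lo)^-1.
  by move=> _; rewrite invr_ge0 subr_ge0 ltW.
(* The uniform law as a one-term mixture of Lebesgue measure on []lo, hi[], so that the mixture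
   lemmas compute its integrals. *)
have mixU : is_mixture (fun=> (hi - lo)^-1) (fun _ : 'I_1 => mrestr lambda mI)
    (uniform_prob lohi).
  by move=> B mB; rewrite big_ord1; exact: uniform_probE.
have iU := integrable_mixture c0 mixU mFr (fun=> iFm).
have intU := Rintegral_mixture c0 mixU mFr (fun=> iFm).
have mEF : measurable_fun [set: borel X] (EFin \o F : borel X -> \bar R).
  exact/measurable_EFinP.
split.
  exact: (integrable_pushforward measurable_itv_retract mEF).
transitivity (\int[uniform_prob lohi]_r Fr r).
  by congr fine; exact: (integral_distribution mEF).
by rewrite intU big_ord1; congr (_ * _).
Qed.

End uniform.
End itv_space.

(** * Representing unimodal and arbitrary laws *)

Section unimodal_representable.
Context (R : realType) (J : set R) (a : J).
Hypothesis iJ : is_interval J.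
Local Notation X := (itv_space a).
Local Notation RR := (measurableTypeR R).
Local Notation lambda := (@lebesgue_measure R).
Local Notation P := (weak_prob R X).
Local Notation prob mu := (mu : probability (borel X) R).
Local Notation ret := (itv_retract a iJ).
Local Notation a0 := (set_val a).

(** Only the open interval between [a] and [z] is known to lie in [J], so [z] is merely in the
    closure. Separate bounds [lo] and [hi] let both sides of the mode use the lemma. *)
Lemma uniform_generator (lo hi z : R) : lo < hi -> (forall x, lo < x < hi -> J x) ->
  lo = Num.min a0 z -> hi = Num.max a0 z ->
  exists2 u : P, uniform_class u & forall F : X -> R,
    measurable_fun [set: borel X] F ->
    lambda.-integrable `]lo, hi[ (EFin \o (F \o ret)) ->
    (prob u).-integrable setT (EFin \o F : borel X -> \bar R) /\
    \int[prob u]_x F x = (hi - lo)^-1 * \int[lambda]_(r in `]lo, hi[) F (ret r).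
Proof.
move=> lohi Jlohi loE hiE.
have Jsub : `]lo, hi[ `<=` J by move=> x; rewrite /= in_itv/=; exact: Jlohi.
exists (uniform_on a iJ lohi); last first.
  by move=> F mF iF; exact: Rintegral_uniform_on.
right; exists z.
  move=> B /nbhs_ballP[e /= e0 Be].
  (* The witness near [z] is at distance at most [e / 2]; comparison with the midpoint keeps it
     inside []lo, hi[]. *)
  have [zhi|zlo] : z = hi \/ z = lo.
    by rewrite loE hiE; case: (leP a0 z) => _; [left|right].
  - exists (Num.max ((lo + hi) / 2) (z - e / 2)); split.
      apply: Jlohi; rewrite lt_max gt_max !midf_lt//=.
      by rewrite zhi ltrBlDr ltrDl divr_gt0.
    apply: Be; rewrite /ball/= ltr_norml.
    by case: (leP ((lo + hi) / 2) (z - e / 2)) => h; apply/andP; split; lra.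
  - exists (Num.min ((lo + hi) / 2) (z + e / 2)); split.
      apply: Jlohi; rewrite lt_min gt_min !midf_lt//=.
      by rewrite zlo ltrDl divr_gt0.
    apply: Be; rewrite /ball/= ltr_norml.
    by case: (leP ((lo + hi) / 2) (z + e / 2)) => h; apply/andP; split; lra.
have az : Num.min a0 z < Num.max a0 z by rewrite -loE -hiE.
exists az => B mB; rewrite uniform_on_line//.
by rewrite /uniform_prob -loE -hiE.
Qed.

Context (mu : P) (n : nat) (F : 'I_n -> X -> R).
Hypothesis unimu : unimodal_class mu.
Hypothesis iF : forall i, (prob mu).-integrable setT (EFin \o F i : borel X -> \bar R).

HB.instance Definition _ :=
  isMeasurableFun.Build _ _ (borel X) RR (set_val : borel X -> RR) (@measurable_set_val R J a).
Let m : probability RR R := distribution (prob mu) (set_val : borel X -> RR).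

(** The law on one piece [D] of the line is not normalised, so its weights sum to the mass of
    [D]. *)
Definition part_representable (D : set RR) := exists s : seq (R * P),
  [/\ forall c, c \in s -> [/\ 0 < c.1, uniform_class c.2 &
        forall i, (prob c.2).-integrable setT (EFin \o F i : borel X -> \bar R)],
      forall i, \sum_(c <- s) c.1 * \int[prob c.2]_x F i x =
        \int[m]_(r in D) F i (ret r) &
      \sum_(c <- s) c.1 = fine (m D)].

Let mF i : measurable_fun [set: borel X] (F i).
Proof. by have /integrableP[/measurable_EFinP] := iF i. Qed.

Let mFret i : measurable_fun [set: RR] (F i \o ret).
Proof. by apply: (measurableT_comp (mF i)); exact: measurable_itv_retract. Qed.

Let iFret i : m.-integrable setT (EFin \o (F i \o ret)).
Proof.
apply: (integrable_pushforward (@measurable_set_val R J a)) => //.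
  exact/measurable_EFinP.
rewrite preimage_setT; apply: eq_integrable (iF i) => // x _.
by rewrite /= set_valK.
Qed.

Let iFretD (D : set RR) i : measurable D -> m.-integrable D (EFin \o (F i \o ret)).
Proof. by move=> mD; apply: integrableS (iFret i). Qed.

Lemma part_representable_seq (T : eqType) (s : seq (R * T)) (D : set RR)
    (v : T -> 'I_n -> R) :
  (forall c, c \in s -> 0 < c.1 /\ exists2 u : P, uniform_class u & forall i,
     (prob u).-integrable setT (EFin \o F i : borel X -> \bar R) /\
     \int[prob u]_x F i x = v c.2 i) ->
  (forall i, \sum_(c <- s) c.1 * v c.2 i = \int[m]_(r in D) F i (ret r)) ->
  \sum_(c <- s) c.1 = fine (m D) ->
  part_representable D.
Proof.
move=> sP sv s1.
pose Q c := [set u : P | uniform_class u /\ forall i,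
     (prob u).-integrable setT (EFin \o F i : borel X -> \bar R) /\
     \int[prob u]_x F i x = v c i].
pose u c := xget mu (Q c).
have uP c : c \in s -> 0 < c.1 /\ Q c.2 (u c.2).
  by move=> /sP[c0 [w Uw wP]]; split=> //; apply: xgetPex; exists w.
exists [seq (c.1, u c.2) | c <- s]; split.
- move=> _ /mapP[c /uP[c0 [Uc cP]] ->]; split=> //= i.
  by have [] := cP i.
- move=> i; rewrite -sv big_map; apply: eq_big_seq => c /uP[_ [_ cP]] /=.
  by have [_ ->] := cP i.
- by rewrite big_map.
Qed.

Lemma part_representableU (A B : set RR) : measurable A -> measurable B ->
  [disjoint A & B] -> part_representable A -> part_representable B ->
  part_representable (A `|` B).
Proof.
move=> mA mB AB [s [sP sI s1]] [t [tP tI t1]]; exists (s ++ t); split.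
- by move=> c; rewrite mem_cat => /orP[/sP|/tP].
- move=> i; rewrite big_cat/= sI tI Rintegral_setU//.
  by apply: integrableS (iFret i) => //; exact: measurableU.
- rewrite big_cat/= s1 t1 measureU//; last by apply/eqP; exact: AB.
  by rewrite fineD// fin_num_measure.
Qed.

(** The mode is the only place where a unimodal law can have an atom, and the Dirac mass at [a]
    accounts for it. *)
Lemma part_representable1 : part_representable [set a0].
Proof.
have ret0 : ret a0 = a by exact: set_valK.
have intE i : \int[m]_(r in [set a0]) F i (ret r) = F i a * fine (m [set a0]).
  rewrite -Rintegral_cst//; apply: eq_Rintegral => r; rewrite inE/= => ->.
  by rewrite ret0.
have [m0|m0] := eqVneq (fine (m [set a0])) 0.
  exists [::]; split=> // [i|]; last by rewrite big_nil m0.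
  by rewrite big_nil intE m0 mulr0.
apply: (@part_representable_seq unit [:: (fine (m [set a0]), tt)] _ (fun _ i => F i a)).
- move=> c; rewrite inE => /eqP -> /=; split.
    by rewrite lt_neqAle eq_sym m0 fine_ge0.
  exists (\d_(a : borel X)); first by left.
  move=> i; have mEF : measurable_fun [set: borel X] (EFin \o F i : borel X -> \bar R).
    exact/measurable_EFinP.
  split.
    apply/integrableP; split=> //.
    have mA : measurable_fun [set: borel X] (fun x => `|(F i x)%:E|%E) by exact: measurableT_comp.
    by rewrite [X in (X < _)%E](integral_dirac _ measurableT mA) diracT mul1e ltry.
  by rewrite /Rintegral integral_dirac// diracT mul1e.
- by move=> i; rewrite big_seq1 intE mulrC.
- by rewrite big_seq1.
Qed.

Lemma cdf_lineB x y : x <= y ->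
  m `]x, y]%classic = (cdf_line mu y - cdf_line mu x)%:E.
Proof.
move=> xy; rewrite /cdf_line EFinB.
have finm (B : set RR) : measurable B -> m B \is a fin_num.
  by move=> mB; exact: fin_num_measure.
rewrite -[on_line mu `]-oo, y]%classic]/(m `]-oo, y]%classic).
rewrite -[on_line mu `]-oo, x]%classic]/(m `]-oo, x]%classic).
rewrite !fineK ?finm//.
have -> : `]-oo, y]%classic = `]-oo, x] `|` `]x, y] :> set RR.
  by rewrite -itv_bndbnd_setU// bnd_simp.
rewrite measureU//; last first.
  apply/seteqP; split=> // r [] /=; rewrite !in_itv/= => rx /andP[xr _].
  by have := lt_le_trans xr rx; rewrite ltxx.
by rewrite addeAC subee ?finm// add0e.
Qed.

Lemma part_representable_right : part_representable `]a0, +oo[.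
Proof.
have concG x y t : a0 < x -> a0 < y -> 0 <= t <= 1 ->
    t * cdf_line mu x + (1 - t) * cdf_line mu y <= cdf_line mu (t * x + (1 - t) * y).
  move=> ax ay /andP[t0 t1].
  have [_ /(_ (Itv01 t0 t1) x y)] := unimu.
  rewrite !inE/= !in_itv/= !andbT => /(_ ax ay).
  by rewrite !convRE/= !mulrN -opprD lerN2.
have slope := concave_homo_slope (fun x y _ => @cdf_lineB x y) concG.
have noninc := concave_slope_noninc (fun x y _ => @cdf_lineB x y) concG.
have [s [sP sI s1]] := right_half slope noninc mFret
  (fun i => iFretD i (measurable_itv _)).
apply: (@part_representable_seq R s _ (fun z i => (z - a0)^-1 *
  \int[lambda]_(x in `]a0, z[) (F i \o ret) x)) => //.
move=> c /sP[c0 az ztail iFz]; split=> //.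
have [|||u Uu uP] := @uniform_generator a0 c.2 c.2 az.
- move=> x /andP[ax xz]; apply: contrapT => nJx.
  have := ztail _ xz.
  rewrite (_ : m _ = 0%E) ?ltxx//.
  rewrite -(measure0 (prob mu)); congr (prob mu _); apply/seteqP; split=> // y.
  rewrite /preimage/= in_itv/= andbT => xy; apply: nJx.
  apply: (iJ (set_valP a) (set_valP y)).
  by rewrite (ltW ax) (ltW xy).
- by rewrite min_l// ltW.
- by rewrite max_r// ltW.
by exists u => // i; exact: uP.
Qed.

Definition flip (r : RR) : RR := - r.

Lemma measurable_flip : measurable_fun setT flip.
Proof. exact: oppr_measurable. Qed.

HB.instance Definition _ := isMeasurableFun.Build _ _ RR RR flip measurable_flip.

Let m' : probability RR R := distribution m flip.

(** Reflection exchanges the closed ends: [m'] of []x, y]] is [m] of [[-y, -x[]. Its primitive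
    therefore involves left limits of [cdf_line]. *)
Let cdf_open y := fine (m `]-oo, y[%classic).

Lemma cvg_cdf_open y : cdf_line mu (y - n.+1%:R^-1) @[n --> \oo] --> cdf_open y.
Proof.
have h0 k : 0 < k.+1%:R^-1 :> R by rewrite invr_gt0.
have finm (B : set RR) : measurable B -> m B \is a fin_num.
  by move=> mB; exact: fin_num_measure.
apply: fine_cvg; rewrite fineK ?finm//.
have E : \bigcup_k `]-oo, (y - k.+1%:R^-1)%R]%classic = `]-oo, y[%classic :> set RR.
  apply/seteqP; split=> r /=.
    move=> [k _] /=; rewrite !in_itv/= => /le_lt_trans; apply.
    by rewrite ltrBlDr ltrDl.
  rewrite in_itv/= => ry; have yr0 : 0 < y - r by rewrite subr_gt0.
  have [k _ kP] := near_infty_natSinv_lt (PosNum yr0).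
  exists k => //=; rewrite in_itv/= lerBrDl -lerBrDr.
  by apply/ltW; exact: (kP k (leqnn k)).
rewrite -E.
apply: (@nondecreasing_cvg_mu _ _ _ m (fun k => `]-oo, (y - k.+1%:R^-1)%R]%classic)).
- by move=> k; exact: measurable_itv.
- by apply: bigcup_measurable => k _; exact: measurable_itv.
- move=> i j ij; apply/subsetPset => r /=; rewrite !in_itv/= => /le_trans; apply.
  by rewrite lerD2l lerN2 lef_pV2 ?posrE ?ltr0n// ler_nat.
Qed.

Lemma flip_itv x y : x <= y ->
  m' `]x, y]%classic = (- cdf_open (- y) - - cdf_open (- x))%:E.
Proof.
move=> xy; change (m (flip @^-1` `]x, y]%classic) = (- cdf_open (- y) - - cdf_open (- x))%:E).
have -> : flip @^-1` `]x, y]%classic = `[(- y), (- x)[%classic.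
  by apply/seteqP; split=> r; rewrite /preimage/= !in_itv/= /flip ltrNr lerNl andbC.
rewrite opprK addrC EFinB /cdf_open !fineK ?fin_num_measure//.
have -> : `]-oo, (- x)[%classic = `]-oo, (- y)[ `|` `[(- y), (- x)[ :> set RR.
  by rewrite -itv_bndbnd_setU// bnd_simp lerN2.
rewrite measureU//; last first.
  apply/seteqP; split=> // r [] /=; rewrite !in_itv/= => ry /andP[yr _].
  by have := lt_le_trans ry yr; rewrite ltxx.
by rewrite addeAC subee ?fin_num_measure// add0e.
Qed.

Lemma part_representable_left : part_representable `]-oo, a0[.
Proof.
have conc x y t : - a0 < x -> - a0 < y -> 0 <= t <= 1 ->
    t * (- cdf_open (- x)) + (1 - t) * (- cdf_open (- y)) <=
    - cdf_open (- (t * x + (1 - t) * y)).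
  move=> ax ay /andP[t0 t1]; rewrite !mulrN -opprD lerN2.
  (* Convexity is known for [cdf_line] and passes to its left limits: all points are shifted by
     [1/(k+1)], which keeps them left of the mode, and [k] tends to infinity. *)
  have cvl := @cvg_cdf_open (- (t * x + (1 - t) * y)).
  have cvr : t * cdf_line mu (- x - n.+1%:R^-1) + (1 - t) * cdf_line mu (- y - n.+1%:R^-1)
      @[n --> \oo] --> t * cdf_open (- x) + (1 - t) * cdf_open (- y).
    by apply: cvgD; apply: cvgMr; exact: cvg_cdf_open.
  apply: (ler_cvg_to cvl cvr); apply: nearW => k.
  have [/(_ (Itv01 t0 t1) (- x - k.+1%:R^-1) (- y - k.+1%:R^-1)) + _] := unimu.
  have k0 : 0 < k.+1%:R^-1 :> R by rewrite invr_gt0.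
  rewrite !inE/= !in_itv/=.
  have lt_a0 z : - a0 < z -> - z - k.+1%:R^-1 < a0.
    by rewrite ltrNl => za; rewrite ltrBlDr (lt_trans za)// ltrDl.
  rewrite (lt_a0 _ ax) (lt_a0 _ ay).
  set h := k.+1%:R^-1; move=> /(_ isT isT).
  have -> : conv (Itv01 t0 t1) (- x - h : convex_lmodType R^o) (- y - h) =
      - (t * x + (1 - t) * y) - h.
    by change (t * (- x - h) + (1 - t) * (- y - h) = - (t * x + (1 - t) * y) - h); ring.
  by [].
have slope := concave_homo_slope (G := fun y => - cdf_open (- y))
  (fun x y _ => @flip_itv x y) conc.
have noninc := concave_slope_noninc (G := fun y => - cdf_open (- y))
  (fun x y _ => @flip_itv x y) conc.
have mflip i : measurable_fun setT (F i \o ret \o flip).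
  exact: (measurableT_comp (mFret i) measurable_flip).
have mL : measurable (`]-oo, a0[%classic : set RR) by exact: measurable_itv.
have mR : measurable (`](- a0), +oo[%classic : set RR) by exact: measurable_itv.
have mflip_itv i : m'.-integrable `](- a0), +oo[ (EFin \o (F i \o ret \o flip)) /\
    \int[m']_(r in `](- a0), +oo[) (F i \o ret) (flip r) =
    \int[m]_(r in `]-oo, a0[) (F i \o ret) r.
  apply: (integrable_transfer mL mR measurable_flip _ (mFret i) (iFretD i mL)).
  move=> B mB; change (m (B `&` `]-oo, a0[) =
    m (flip @^-1` (flip @^-1` B `&` `](- a0), +oo[))); congr (m _).
  by apply/seteqP; split=> r; rewrite /preimage/= !in_itv/= andbT /flip opprK ltrN2.
have [s [sP sI s1]] := right_half slope noninc mflip (fun i => (mflip_itv i).1).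
apply: (@part_representable_seq R s _ (fun z i => (z - - a0)^-1 *
  \int[lambda]_(x in `](- a0), z[) (F i \o ret \o flip) x)).
- move=> c /sP[c0 az ztail iFz]; split=> //.
  have za : - c.2 < a0 by rewrite ltrNl.
  have [|||u Uu uP] := @uniform_generator (- c.2) a0 (- c.2) za.
  + move=> x /andP[zx xa]; apply: contrapT => nJx.
    have := ztail (- x); rewrite ltrNl => /(_ zx).
    rewrite (_ : m' _ = 0%E) ?ltxx//.
    rewrite -(measure0 (prob mu)).
    change (m (flip @^-1` `](- x), +oo[%classic) = prob mu set0).
    congr (prob mu _); apply/seteqP; split=> // y.
    rewrite /preimage/= in_itv/= andbT /flip ltrN2 => yx; apply: nJx.
    apply: (iJ (set_valP y) (set_valP a)).
    by rewrite (ltW yx) (ltW xa).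
  + by rewrite min_r// ltW.
  + by rewrite max_l// ltW.
  exists u => // i.
  have mI : measurable (`](- a0), c.2[%classic : set RR) by exact: measurable_itv.
  have mI' : measurable (`](- c.2), a0[%classic : set RR) by exact: measurable_itv.
  have [|iI II] := integrable_transfer (m2 := lambda) mI mI' measurable_flip _ (mflip i) (iFz i).
    move=> B mB; rewrite -[LHS]lebesgue_measureN; last exact: measurableI.
    congr (lambda _); apply/seteqP.
    by split=> r; rewrite /preimage/= !in_itv/= /flip ltrN2 ltrNl andbC.
  have flipK : (F i \o ret \o flip) \o flip = F i \o ret.
    by apply/funext => r /=; rewrite /flip opprK.
  rewrite flipK in iI.
  have [iu Iu] := uP _ (mF i) iI; split=> //.
  rewrite Iu; congr (_ * _); first by rewrite !opprK addrC.
  by rewrite -II; congr (fine (integral _ _ _)); apply/funext => r; rewrite /= /flip opprK.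
- move=> i; apply: etrans (sI i) _; exact: (mflip_itv i).2.
- rewrite s1; congr fine.
  change (m (flip @^-1` `](- a0), +oo[%classic) = m `]-oo, a0[%classic).
  by congr (m _); apply/seteqP; split=> r; rewrite /preimage/= !in_itv/= andbT /flip ltrN2.
Qed.

Lemma part_representableT : part_representable setT.
Proof.
have -> : [set: RR] = (`]-oo, a0[ `|` [set a0]) `|` `]a0, +oo[.
  apply/seteqP; split=> // r _; rewrite /= !in_itv/= andbT.
  by case: (ltgtP r a0) => [| |->]; [left; left|right|left; right].
have mL : measurable (`]-oo, a0[%classic : set RR) by exact: measurable_itv.
have mR : measurable (`]a0, +oo[%classic : set RR) by exact: measurable_itv.
apply: part_representableU => //.
- exact: measurableU.
- apply/disj_setPS => r [[]]/=; rewrite !in_itv/= andbT.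
    by move=> ra /(lt_trans ra); rewrite ltxx.
  by move=> ->; rewrite ltxx.
- apply: part_representableU => //.
  + by apply/disj_setPS => r []/=; rewrite in_itv/= => /[swap] ->; rewrite ltxx.
  + exact: part_representable_left.
  + exact: part_representable1.
- exact: part_representable_right.
Qed.

End unimodal_representable.

Section exactly_representable.
Context (R : realType) (T : ptopologicalType).
Local Notation P := (weak_prob R T).
Local Notation prob mu := (mu : probability (borel T) R).

Lemma exactly_representable_seq (U : set P) (mu : P) :
  (forall n (F : 'I_n -> T -> R),
     (forall i, (prob mu).-integrable setT (EFin \o F i : borel T -> \bar R)) ->
     exists s : seq (R * P), [/\ forall c, c \in s -> [/\ 0 < c.1, U c.2 &
        forall i, (prob c.2).-integrable setT (EFin \o F i : borel T -> \bar R)],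
      forall i, \sum_(c <- s) c.1 * \int[prob c.2]_x F i x =
        \int[prob mu]_x F i x &
      \sum_(c <- s) c.1 = 1]) ->
  exactly_representable U mu.
Proof.
move=> H I F iF.
have [i|s [sP sI s1]] := H #|I| (fun i => F (enum_val i)); first exact: iF.
pose c k := tnth (in_tuple s) k.
have cs k : c k \in s by exact: mem_tnth.
exists (size s), (fun k => (c k).1), (fun k => (c k).2); split.
- by move=> k; have [] := sP _ (cs k).
- by apply: etrans s1; rewrite [RHS]big_tnth.
- move=> k i; have [_ _ /(_ (enum_rank i))] := sP _ (cs k).
  by rewrite enum_rankK.
- move=> i; have := sI (enum_rank i); rewrite enum_rankK => <-.
  by rewrite [RHS]big_tnth.
Qed.

(** Taking [h = 1] in [exists_combination] makes the weights sum to 1. *)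
Lemma dirac_representable (mu : P) : exactly_representable (@dirac_class R T) mu.
Proof.
apply: exactly_representable_seq => n F iF.
have mF i : measurable_fun [set: borel T] (EFin \o F i : borel T -> \bar R).
  by have /integrableP[] := iF i.
have i1 : (prob mu).-integrable setT (EFin \o cst (1 : R)).
  exact: finite_measure_integrable_cst.
have int1 : \int[prob mu]_x cst (1 : R) x = 1.
  by rewrite Rintegral_cst// mul1r [X in fine X](probability_setT (prob mu)).
have [|s [s0 sF s1]] := exists_combination i1 (fun=> ler01) _ iF.
  by rewrite int1.
exists [seq (c.1, (\d_(c.2 : borel T) : P)) | c <- s]; split.
- move=> _ /mapP[c cs ->] /=; split; first exact: (allP s0 _ cs).
    by exists c.2.
  move=> i; apply/integrableP; split=> //.
  have mA : measurable_fun [set: borel T] (fun x => `|(F i x)%:E|%E).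
    exact: measurableT_comp (mF i).
  by rewrite [X in (X < _)%E](integral_dirac _ measurableT mA) diracT mul1e ltry.
- move=> i; rewrite -sF big_map; apply: eq_bigr => c _ /=.
  by rewrite /Rintegral [X in fine X](integral_dirac _ measurableT (mF i)) diracT mul1e.
- rewrite big_map -[RHS]int1 -s1; apply: eq_bigr => c _ /=; by rewrite mulr1.
Qed.

End exactly_representable.

Lemma unimodal_representable (R : realType) (J : set R) (a : J) (mu : weak_prob R (itv_space a)) :
  is_interval J -> unimodal_class mu ->
  exactly_representable (@uniform_class R J a) mu.
Proof.
move=> iJ unimu; apply: exactly_representable_seq => n F iF.
have [s [sP sI s1]] := part_representableT iJ unimu iF.
exists s; split=> //.
- move=> i; rewrite sI; have mF : measurable_fun [set: borel (itv_space a)] (F i).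
    by have /integrableP[/measurable_EFinP] := iF i.
  have mret := @measurable_itv_retract R J a iJ.
  have mFret := measurableT_comp mF mret.
  have mEFret : measurable_fun setT (EFin \o (F i \o itv_retract a iJ)).
    exact/measurable_EFinP.
  have FE : F i = F i \o itv_retract a iJ \o set_val.
    by apply/funext => x /=; rewrite set_valK.
  rewrite [in RHS]FE; congr fine; apply: (integral_distribution mEFret).
  by apply: eq_integrable (iF i) => // x _; rewrite /= set_valK.
- by rewrite s1 [X in fine X](probability_setT _).
Qed.

(** * Uniform laws and mixtures are unimodal *)

Section convex_combination.
Context (R : realType).
Implicit Types x y t b : R.

Lemma conv_max b x y t : 0 <= t <= 1 ->
  Num.max b (t * x + (1 - t) * y) <= t * Num.max b x + (1 - t) * Num.max b y.
Proof.
move=> /andP[t0 t1]; have t1' : 0 <= 1 - t by rewrite subr_ge0.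
rewrite ge_max; apply/andP; split.
  rewrite [leLHS](_ : b = t * b + (1 - t) * b); last by ring.
  by apply: lerD; apply: ler_wpM2l => //; rewrite le_max lexx.
by apply: lerD; apply: ler_wpM2l => //; rewrite le_max lexx orbT.
Qed.

Lemma conv_min b x y t : 0 <= t <= 1 ->
  t * Num.min x b + (1 - t) * Num.min y b <= Num.min (t * x + (1 - t) * y) b.
Proof.
move=> t01; have := conv_max (- b) (- x) (- y) t01.
have -> : t * - x + (1 - t) * - y = - (t * x + (1 - t) * y) by ring.
rewrite -!oppr_min ![Num.min b _]minC => H; lra.
Qed.

Lemma conv_lt b x y t : x < b -> y < b -> 0 <= t <= 1 ->
  t * x + (1 - t) * y < b.
Proof.
move=> xb yb /andP[t0 t1]; apply: (@le_lt_trans _ _ (Num.max x y)).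
  rewrite [leRHS](_ : _ = t * Num.max x y + (1 - t) * Num.max x y); last by ring.
  by apply: lerD; apply: ler_wpM2l; rewrite ?subr_ge0// le_max lexx ?orbT.
by rewrite gt_max xb.
Qed.

Lemma conv_gt b x y t : b < x -> b < y -> 0 <= t <= 1 ->
  b < t * x + (1 - t) * y.
Proof.
rewrite -ltrN2 -[b < y]ltrN2 => xb yb t01; rewrite -ltrN2.
have -> : - (t * x + (1 - t) * y) = t * - x + (1 - t) * - y by ring.
exact: conv_lt.
Qed.

End convex_combination.

Section unimodal_class_facts.
Context (R : realType) (J : set R) (a : J).
Local Notation X := (itv_space a).
Local Notation RR := (measurableTypeR R).
Local Notation P := (weak_prob R X).
Local Notation a0 := (set_val a).

Lemma measurable_preimage_val (B : set RR) : measurable B ->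
  measurable ((set_val : borel X -> RR) @^-1` B).
Proof.
by move=> mB; rewrite -[X in measurable X]setTI; exact: measurable_set_val.
Qed.

Lemma convex_functionP (D : set R^o) (f : R -> R) :
  (forall x y t : R, D x -> D y -> 0 <= t <= 1 ->
    f (t * x + (1 - t) * y) <= t * f x + (1 - t) * f y) ->
  convex_function D f.
Proof.
move=> H t x y; rewrite !inE => Dx Dy; apply: H => //.
by apply/andP; split.
Qed.

Lemma convex_functionE (D : set R^o) (f : R -> R) (x y t : R) :
  convex_function D f -> D x -> D y -> 0 <= t <= 1 ->
    f (t * x + (1 - t) * y) <= t * f x + (1 - t) * f y.
Proof.
move=> cf Dx Dy /andP[t0 t1].
by apply: (cf (Itv01 t0 t1) x y); rewrite inE.
Qed.

Lemma unimodal_mixture_closed : mixture_closed (@unimodal_class R J a).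
Proof.
move=> K w u mu w0 w1 Uu muE.
have cdfE h : cdf_line mu h = \sum_k w k * cdf_line (u k) h.
  have mh := measurable_preimage_val (measurable_itv `]-oo, h]).
  rewrite /cdf_line /on_line muE//.
  rewrite (eq_bigr (fun k => (w k * fine (on_line (u k) `]-oo, h]%classic))%:E)).
    by rewrite sumEFin.
  by move=> k _; rewrite EFinM fineK// fin_num_measure.
(* The sign [s] is 1 for the convex half and -1 for the concave half. *)
have conv s (D : set R^o) : (forall k, convex_function D (s \*o cdf_line (u k))) ->
    convex_function D (s \*o cdf_line mu).
  move=> cu; apply: convex_functionP => x y t Dx Dy t01 /=.
  rewrite !cdfE !mulr_sumr -big_split/=; apply: ler_sum => k _.
  have := convex_functionE (cu k) Dx Dy t01 => /= /(ler_wpM2l (w0 k)).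
  by congr (_ <= _); ring.
have mulN1 (f : R -> R) : - f = (-1) \*o f by apply/funext => x; rewrite /= mulN1r.
have mul1 (f : R -> R) : f = 1 \*o f by apply/funext => x; rewrite /= mul1r.
split.
  by rewrite (mul1 (cdf_line mu)); apply: conv => k; rewrite -mul1; have [] := Uu k.
by rewrite mulN1; apply: conv => k; rewrite -mulN1; have [] := Uu k.
Qed.

Lemma uniform_prob_cdf (lo hi h : R) (lohi : lo < hi) :
  fine (uniform_prob lohi `]-oo, h]) =
  (hi - lo)^-1 * (Num.max lo (Num.min h hi) - lo).
Proof.
rewrite uniform_probE//.
have [hlo|loh] := leP h lo.
  rewrite (_ : _ `&` _ = set0) ?measure0 ?mule0/=.
    by rewrite min_l ?(le_trans hlo (ltW lohi))// max_l// subrr mulr0.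
  apply/seteqP; split=> // x []/=; rewrite !in_itv/= => xh /andP[lox _].
  by have := lt_le_trans lox (le_trans xh hlo); rewrite ltxx.
have [hhi|hih] := leP hi h.
  rewrite (_ : _ `&` _ = `]lo, hi[%classic); last first.
    apply: setIidr => x /=; rewrite !in_itv/= => /andP[_ /ltW xhi].
    exact: le_trans hhi.
  rewrite [X in (_ * X)%E]lebesgue_measure_itv/= lte_fin lohi/= max_r//; exact: ltW.
rewrite (_ : _ `&` _ = `]lo, h]%classic); last first.
  apply/seteqP; split=> x /=; rewrite !in_itv/=; first by move=> [-> /andP[->]].
  by move=> /andP[-> xh]; rewrite xh (le_lt_trans xh).
by rewrite [X in (_ * X)%E]lebesgue_measure_itv/= lte_fin loh/= max_r// ltW.
Qed.

(** The distribution function is affine, with slope [c >= 0], in the truncation of [h] to the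
    interval. On the side of [z] only one truncation is active: a maximum, convex, if [z < a], or a
    minimum, concave, if [a < z]. On the other side it is constant. *)
Lemma uniform_unimodal : @uniform_class R J a `<=` @unimodal_class R J a.
Proof.
move=> u [uE|[z Jz [az uE]]].
  have cdfE h : cdf_line u h = (a0 <= h)%R%:R.
    rewrite /cdf_line /on_line uE; last exact: measurable_preimage_val.
    rewrite diracE/=; congr ((nat_of_bool _)%:R).
    by apply/idP/idP; rewrite inE /preimage/= in_itv.
  split; apply: convex_functionP => x y t; rewrite /= !in_itv/= ?andbT => xa ya t01.
    have := conv_lt xa ya t01; rewrite !cdfE !ltNge => /negbTE ->.
    move: xa ya; rewrite !ltNge => /negbTE -> /negbTE ->.
    by rewrite !mulr0 addr0.
  have /ltW := conv_gt xa ya t01; rewrite !opprfctE !cdfE => ->.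
  by rewrite (ltW xa) (ltW ya) -mulrDl subrKC mul1r.
pose c := (Num.max a0 z - Num.min a0 z)^-1.
have cdfE h : cdf_line u h =
    c * (Num.max (Num.min a0 z) (Num.min h (Num.max a0 z)) - Num.min a0 z).
  by rewrite /cdf_line uE//; exact: uniform_prob_cdf.
have c0 : 0 <= c by rewrite invr_ge0 subr_ge0 ltW.
clearbody c.
have [za|az'] := leP z a0.
  have za' : z < a0 by have := az; rewrite min_r// max_l.
  rewrite (min_r za) (max_l za) in cdfE.
  split; apply: convex_functionP => x y t; rewrite /= !in_itv/= ?andbT => xa ya t01.
    have ca := conv_lt xa ya t01.
    rewrite !cdfE (min_l (ltW ca)) (min_l (ltW xa)) (min_l (ltW ya)).
    have /(ler_wpM2l c0) := conv_max z x y t01.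
    move=> H; rewrite -subr_ge0 in H; rewrite -subr_ge0; move: H.
    by congr (_ <= _); ring.
  have ca := conv_gt xa ya t01.
  rewrite !opprfctE !cdfE (min_r (ltW ca)) (min_r (ltW xa)) (min_r (ltW ya)).
  by rewrite le_eqVlt; apply/orP; left; apply/eqP; ring.
rewrite (min_l (ltW az')) (max_r (ltW az')) in cdfE.
split; apply: convex_functionP => x y t; rewrite /= !in_itv/= ?andbT => xa ya t01.
  have ca := conv_lt xa ya t01.
  have E h : h < a0 -> Num.max a0 (Num.min h z) = a0.
    by move=> ha; rewrite max_l// ge_min ltW.
  by rewrite !cdfE !E// subrr !mulr0 addr0.
have ca := conv_gt xa ya t01.
have E h : a0 < h -> Num.max a0 (Num.min h z) = Num.min h z.
  by move=> ah; rewrite max_r// le_min !ltW.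
rewrite !opprfctE !cdfE !E//.
have /(ler_wpM2l c0) := conv_min z x y t01.
move=> H; rewrite -subr_ge0 in H; rewrite -subr_ge0; move: H.
    by congr (_ <= _); ring.
Qed.

End unimodal_class_facts.

(** * Replacing the marginals one by one *)

Section replacement.
Context (R : realType) (p q : nat)
  (S : 'I_p -> ptopologicalType) (J : 'I_q -> set R) (a : forall k, J k)
  (Nm : 'I_p + 'I_q -> nat)
  (phi : forall i, 'I_(Nm i) -> factor_space S a i -> R)
  (N : nat) (Phi : 'I_N -> product_space S a -> R)
  (f : measure_tuple S a -> R).
Hypotheses (iJ : forall k, is_interval (J k))
  (mphi : forall i j, measurable_fun [set: borel (factor_space S a i)] (@phi i j))
  (mPhi : forall j, measurable_fun [set: product_space S a] (Phi j))
  (qcf : marginally (fun i => @quasi_convex_on R (factor_space S a i))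
    (moment_class (@phi)) f)
  (lscf : marginally (fun i => @lower_semicontinuous_on R (factor_space S a i))
    (moment_class (@phi)) f).

Local Notation F := (factor_space S a).

Lemma base_class_mixture_closed i : mixture_closed (@base_class R p q S J a i).
Proof.
by case: i => k //=; exact: unimodal_mixture_closed.
Qed.

Lemma generators_base_class i :
  @generators R p q S J a i `<=` @base_class R p q S J a i.
Proof. by case: i => k //=; exact: uniform_unimodal. Qed.

Lemma base_class_representable i (mu : weak_prob R (F i)) :
  @base_class R p q S J a i mu -> exactly_representable (@generators R p q S J a i) mu.
Proof.
case: i mu => k mu /=; first by move=> _; exact: dirac_representable.
by apply: unimodal_representable; exact: iJ.
Qed.

Lemma replace_coord (mu : measure_tuple S a) (c : R) i :
  feasible (moment_class (@phi)) Phi mu -> c < f mu ->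
  exists nu : weak_prob R (F i), [/\ Delta (@phi) (Nm i + N) i nu,
    feasible (moment_class (@phi)) Phi (dfwith mu i nu) &
    c < f (dfwith mu i nu)].
Proof.
move=> [mumc muPhi] cf.
pose T k : measurableType (@open (F k)).-sigma := borel (F k).
pose mup k : probability (T k) R := mu k.
(* Lets the lemmas on a replaced coordinate speak about [mu] itself. *)
have mu_id : dfwith mu i (mu i) = mu.
  apply: functional_extensionality_dep => k.
  by have [<-|ik] := eqVneq i k; rewrite ?dfwithin ?dfwithout.
pose chi j : T i -> R := section_int mup (i := i) (Phi j).
pose L j : T i -> R := section_norm mup (i := i) (Phi j).
pose E : set (T i) := \bigcup_(j in [set: 'I_N]) bad_sections mup (i := i) (Phi j).
pose C := [set nu : weak_prob R (F i) | forall j,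
  expectation_le0 (product_measure (dfwith mu i nu)) (Phi j)].
have mbad j : measurable (bad_sections mup (i := i) (Phi j)).
  exact: measurable_bad_sections.
have mE : measurable E by apply: fin_bigcup_measurable.
have E0P (nu : probability (T i) R) :
    nu E = 0%E <-> forall j, nu (bad_sections mup (i := i) (Phi j)) = 0%E.
  split=> [nuE j|nu0].
    apply/eqP; rewrite eq_le measure_ge0 andbT -nuE.
    by apply: le_measure; rewrite ?inE// => x bx; exists j.
  have bad_ae j : {ae nu, forall x, ~ bad_sections mup (i := i) (Phi j) x}.
    exists (bad_sections mup (i := i) (Phi j)); split=> // x /= nnx.
    exact: contrapT.
  have [M [mM M0 EM]] := filter_forall (ae_filter_ringOfSetsType nu) bad_ae.
  apply/eqP; rewrite eq_le measure_ge0 andbT -M0.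
  apply: le_measure; rewrite ?inE// => x [j _ bx].
  by apply: EM => /= /(_ j).
have int_mu j := (expectation_le0P _ _).1 (muPhi j).
have iPhi j : (prod_prob (dfwith mup i (mup i))).-integrable setT (EFin \o Phi j).
  have [iP _] := int_mu j.
  have : (product_measure (dfwith mu i (mu i))).-integrable setT (EFin \o Phi j).
    by rewrite mu_id.
  by [].
have iffPhi j (nu : weak_prob R (F i)) :=
  integrable_sections mup (i := i) (mPhi j) (nu : probability (T i) R).
have intPhi j (nu : weak_prob R (F i)) :=
  @Rintegral_sections R _ _ T mup i (Phi j) (mPhi j) (nu : probability (T i) R).
have [|||||||||||nu [Anu mixnu Cnu cnu]] := @one_factor_reduction R (F i)
  (@base_class R p q S J a i) (@generators R p q S J a i)
  (@base_class_mixture_closed i) (@generators_base_class i)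
  (@base_class_representable i) (Nm i) (@phi i) (@mphi i) N N chi L E C _ _ mE _
  (fun nu => f (dfwith mu i nu)) (mu i) c.
- by move=> j; exact: measurable_section_int.
- by move=> j; exact: measurable_section_norm.
- move=> nu _ iL nuE chi0 j.
  have iP := (iffPhi j nu).2 (conj ((E0P nu).1 nuE j) (iL j)).
  apply/expectation_le0P; split; first exact: iP.
  have [_ intE] := intPhi j nu iP.
  by apply: le_trans (chi0 j); rewrite -intE.
- by apply: qcf => k _; exact: mumc.
- by apply: lscf => k _; exact: mumc.
- exact: mumc.
- by move=> j; have [] := intPhi j _ (iPhi j).
- by move=> j; have [] := (iffPhi j _).1 (iPhi j).
- by apply: (E0P (mu i)).2 => j; have [] := (iffPhi j _).1 (iPhi j).
- move=> j; have [_ <-] := intPhi j _ (iPhi j).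
  have [_] := int_mu j; rewrite -[in X in X -> _]mu_id.
  by [].
- by rewrite mu_id.
exists nu; split=> //.
split=> // k; have [<-|ik] := eqVneq i k; first by rewrite dfwithin.
by rewrite dfwithout.
Qed.

(** A replacement leaves the other coordinates as they are, and returns the same hypotheses with the
    same [c], so no loss accumulates. *)
Lemma replace_coords (mu : measure_tuple S a) (c : R) (s : seq ('I_p + 'I_q)) :
  feasible (moment_class (@phi)) Phi mu -> c < f mu ->
  exists nu : measure_tuple S a,
    [/\ forall i, i \in s -> Delta (@phi) (Nm i + N) i (nu i),
        feasible (moment_class (@phi)) Phi nu & c < f nu].
Proof.
move=> mufeas cf; elim: s => [|i s [mu' [Ds feas' cf']]]; first by exists mu.
have [nu [Dnu feasnu cnu]] := replace_coord i feas' cf'.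
exists (dfwith mu' i nu); split=> // k; rewrite inE.
have [<- _|ik] := eqVneq i k; first by rewrite dfwithin.
by rewrite dfwithout//= => ks; apply: Ds.
Qed.

End replacement.

Theorem theorem3p2 (R : realType) (p q : nat)
    (S : 'I_p -> ptopologicalType) (J : 'I_q -> set R) (a : forall k, J k)
    (Nm : 'I_p + 'I_q -> nat)
    (phi : forall i, 'I_(Nm i) -> factor_space S a i -> R)
    (N : nat) (Phi : 'I_N -> product_space S a -> R)
    (f : measure_tuple S a -> R) :
  (forall k, suslin R (S k)) ->
  (forall k, is_interval (J k)) ->
  (forall i j, measurable_fun [set: borel (factor_space S a i)] (phi i j)) ->
  (forall j, measurable_fun [set: product_space S a] (Phi j)) ->
  marginally (fun i => @quasi_convex_on R (factor_space S a i))
    (moment_class phi) f ->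
  marginally (fun i => @lower_semicontinuous_on R (factor_space S a i))
    (moment_class phi) f ->
  ereal_sup [set (f mu)%:E | mu in feasible (moment_class phi) Phi] =
  ereal_sup [set (f mu)%:E |
    mu in feasible (fun i => Delta phi (Nm i + N) i) Phi].
Proof.
move=> _ iJ mphi mPhi qcf lscf; apply/eqP; rewrite eq_le; apply/andP; split.
  apply: ge_ereal_sup => _ [mu mufeas <-].
  (* The reduction starts from a strict inequality, so it is run at level [f mu - e]. *)
  apply/lee_subgt0Pr => e e0; rewrite -EFinB.
  have [|nu [Dnu [_ nuPhi] cnu]] := replace_coords iJ mphi mPhi qcf lscf
      (c := f mu - e) (index_enum _) mufeas.
    by rewrite ltrBlDr ltrDl.
  apply: (@le_trans _ _ (f nu)%:E); first by rewrite lee_fin ltW.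
  apply: ereal_sup_ubound; exists nu => //; split=> // i.
  by apply: Dnu; rewrite mem_index_enum.
apply: le_ereal_sup => _ [mu [muD muPhi] <-]; exists mu => //.
by split=> // i; have [] := muD i.
Qed.
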